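(* Let $(A_S,S)$ be an Artin–Tits system of spherical type and let $X\subset S$. Then there is a group isomorphism $$N_{A_S}(A_X)/(Z_{A_S}(A_X)\cdot A_X)\ \simeq\ N_{W_S}(W_X)/(Z_{W_S}(W_X)\cdot W_X).$$
   Context: Let $S$ be a finite set and $M=(m_{s,t})_{s,t\in S}$ a symmetric matrix with $m_{s,s}=1$ and $m_{s,t}\in\{2,3,\dots\}\cup\{\infty\}$ for $s\neq t$. The associated Artin–Tits system is $(A_S,S)$, where $A_S$ is the group with generators $S$ and relations $\underbrace{sts\cdots}_{m_{s,t}}=\underbrace{tst\cdots}_{m_{s,t}}$ for all $s\ne t$ in $S$ with $m_{s,t}\neq\infty$. The associated Coxeter group $W_S$ is obtained by adding the relations $s^2=1$, $s\in S$. One says that $A_S$ is of spherical type if $W_S$ is finite. For $X\subset S$, $A_X$ (resp. $W_X$) is the subgroup of $A_S$ (resp. $W_S$) generated by $X$. Notation: $Z_{A_S}(A_X)=\{g\in A_S\mid gs=sg\ \forall s\in X\}$ is the centralizer and $N_{A_S}(A_X)=\{g\in A_S\mid gX\subset A_Xg\}$ the normalizer of $A_X$ in $A_S$; $Z_{W_S}(W_X)$ and $N_{W_S}(W_X)$ denote the centralizer and the normalizer of $W_X$ in $W_S$. *)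

(* Defs.v *)
From HB Require Import structures.
From mathcomp Require Import all_boot.
From mathcomp Require Import boolp classical_sets cardinality.

Set Implicit Arguments.
Unset Strict Implicit.
Unset Printing Implicit Defensive.

Local Open Scope classical_set_scope.
Local Open Scope quotient_scope.
Local Open Scope group_scope.

(** * Group presentations *)

(* The letter [(s, true)] stands for [s], and [(s, false)] for [s^-1]. *)
Notation word S := (seq (S * bool)%type).

Definition winv (S : Type) (w : word S) : word S :=
  rev [seq (l.1, ~~ l.2) | l <- w].

Section Presentation.
Variables (S : choiceType) (R : word S -> word S -> Prop).

(* The congruence on words generated by free reduction and by [u = v] for
   [R u v]. *)
Inductive wcongr : word S -> word S -> Prop :=
| wcongr_refl u : wcongr u u
| wcongr_sym u v : wcongr u v -> wcongr v u
| wcongr_trans u v w : wcongr u v -> wcongr v w -> wcongr u w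
| wcongr_cat u u' v v' : wcongr u u' -> wcongr v v' -> wcongr (u ++ v) (u' ++ v')
| wcongr_cancel s b : wcongr [:: (s, b); (s, ~~ b)] [::]
| wcongr_rel u v : R u v -> wcongr u v.

Definition wcongrb (u v : word S) : bool := `[< wcongr u v >].

Lemma wcongrb_equiv : equiv_class_of wcongrb.
Proof.
split=> [u|u v|v u w].
- exact/asboolP/wcongr_refl.
- by apply/asboolP/asboolP; apply: wcongr_sym.
- by move=> /asboolP uv /asboolP vw; apply/asboolP/(wcongr_trans uv vw).
Qed.

Canonical wcongrb_equiv_rel := EquivRelPack wcongrb_equiv.

Definition presented_group : Type := {eq_quot wcongrb}.
HB.instance Definition _ := Choice.on presented_group.

Definition class_of_word (w : word S) : presented_group := \pi w.

Lemma class_of_wordP u v : class_of_word u = class_of_word v <-> wcongr u v.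
Proof.
split=> [/eqmodP/asboolP //|uv]; exact/eqmodP/asboolP.
Qed.

Lemma class_of_repr (x : presented_group) :
  class_of_word (repr (x : {eq_quot wcongrb})) = x.
Proof. exact: reprK. Qed.

Lemma wcongr_repr w :
  wcongr (repr (class_of_word w : {eq_quot wcongrb})) w.
Proof. by apply/class_of_wordP; rewrite class_of_repr. Qed.

Lemma wcongr_mulVw w : wcongr (winv w ++ w) [::].
Proof.
elim: w => [|[s b] w IHw]; first exact: wcongr_refl.
rewrite /winv /= rev_cons cat_rcons.
have sb : wcongr ((s, ~~ b) :: (s, b) :: w) w.
  rewrite -[X in wcongr _ X]cat0s -[X in wcongr X _]/([:: (s, ~~ b); (s, b)] ++ w).
  apply: wcongr_cat (wcongr_refl _).
  by rewrite -{2}[b]negbK; apply: wcongr_cancel.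
exact: wcongr_trans (wcongr_cat (wcongr_refl _) sb) IHw.
Qed.

Lemma winvK (w : word S) : winv (winv w) = w.
Proof.
rewrite /winv map_rev revK -map_comp -[RHS]map_id.
by apply: eq_map => -[s b] /=; rewrite negbK.
Qed.

Lemma wcongr_mulwV w : wcongr (w ++ winv w) [::].
Proof. by rewrite -{1}[w]winvK; apply: wcongr_mulVw. Qed.

Lemma wcongr_inv u v : wcongr u v -> wcongr (winv u) (winv v).
Proof.
move=> uv.
apply: (@wcongr_trans _ (winv u ++ (v ++ winv v))).
  rewrite -{1}[winv u]cats0; apply: wcongr_cat (wcongr_refl _) _.
  exact/wcongr_sym/wcongr_mulwV.
rewrite catA -[X in wcongr _ X]cat0s; apply: wcongr_cat (wcongr_refl _).
apply: wcongr_trans (wcongr_mulVw u).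
exact: wcongr_cat (wcongr_refl _) (wcongr_sym uv).
Qed.

Definition pres_mul (x y : presented_group) : presented_group :=
  class_of_word (repr (x : {eq_quot wcongrb}) ++ repr (y : {eq_quot wcongrb})).
Definition pres_one : presented_group := class_of_word [::].
Definition pres_inv (x : presented_group) : presented_group :=
  class_of_word (winv (repr (x : {eq_quot wcongrb}))).

Lemma pres_mulE u v :
  pres_mul (class_of_word u) (class_of_word v) = class_of_word (u ++ v).
Proof.
by apply/class_of_wordP; apply: wcongr_cat; apply: wcongr_repr.
Qed.

Lemma pres_invE u : pres_inv (class_of_word u) = class_of_word (winv u).
Proof. by apply/class_of_wordP/wcongr_inv/wcongr_repr. Qed.

Fact pres_mulA : associative pres_mul.
Proof.
move=> x y z; rewrite -[x]class_of_repr -[y]class_of_repr -[z]class_of_repr.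
by rewrite !pres_mulE catA.
Qed.

Fact pres_mul1 : left_id pres_one pres_mul.
Proof. by move=> x; rewrite -[x]class_of_repr pres_mulE. Qed.

Fact pres_mulr1 : right_id pres_one pres_mul.
Proof. by move=> x; rewrite -[x]class_of_repr pres_mulE cats0. Qed.

Fact pres_mulV : left_inverse pres_one pres_inv pres_mul.
Proof.
move=> x; rewrite -[x]class_of_repr pres_invE pres_mulE.
exact/class_of_wordP/wcongr_mulVw.
Qed.

Fact pres_mulrV : right_inverse pres_one pres_inv pres_mul.
Proof.
move=> x; rewrite -[x]class_of_repr pres_invE pres_mulE.
exact/class_of_wordP/wcongr_mulwV.
Qed.

HB.instance Definition _ := isGroup.Build presented_group
  pres_mulA pres_mul1 pres_mulr1 pres_mulV pres_mulrV.

Definition pres_gen (s : S) : presented_group := class_of_word [:: (s, true)].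

End Presentation.

(** * Subgroups and quotients of possibly infinite groups *)

Section Subgroups.
Variable G : groupType.
Implicit Types (A B H K N : set G) (g : G).

Definition is_subgroup H : Prop :=
  [/\ H 1, forall x y, H x -> H y -> H (x * y) & forall x, H x -> H x^-1].

Definition generated A : set G := smallest is_subgroup A.

Definition set_mul A B : set G := [set x * y | x in A & y in B].

Definition centralizer A : set G := [set g | forall x, A x -> g * x = x * g].

Definition normalizer H : set G := [set g | [set g * h * g^-1 | h in H] = H].

Definition normal_in K N : Prop :=
  [/\ is_subgroup N, is_subgroup K, K `<=` N &
      forall g k, N g -> K k -> K (g * k * g^-1)].

Definition lcoset g K : set G := [set g * k | k in K].

(* The carrier of [N / K]: the cosets [g K] with [g] in [N]. *)
Record quotient_group K N (nKN : normal_in K N) := Coset {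
  coset_set :> set G;
  cosetP : exists2 g, N g & coset_set = lcoset g K }.

End Subgroups.

Section Quotient.
Variables (G : groupType) (K N : set G) (nKN : normal_in K N).
Local Notation Q := (quotient_group nKN).

Lemma coset_inj : injective (@coset_set G K N nKN).
Proof.
move=> [C PC] [D PD] /= CD; case: _ / CD in PD *.
by congr Coset; apply: Prop_irrelevance.
Qed.

HB.instance Definition _ := gen_eqMixin Q.
HB.instance Definition _ := gen_choiceMixin Q.

Lemma lcoset_mul g h : N g -> N h ->
  set_mul (lcoset g K) (lcoset h K) = lcoset (g * h) K.
Proof.
case: nKN => -[N1 NM NV] [K1 KM KV] KN nK Ng Nh; apply/seteqP; split=> x /=.
- move=> [_ [k Kk <-]] [_ [l Kl <-]] <-.
  exists (h^-1 * k * h^-1^-1 * l).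
    by apply: KM => //; apply: nK => //; apply: NV.
  by rewrite invgK !mulgA mulgK.
- move=> [k Kk <-]; exists g; first by exists 1; rewrite ?mulg1.
  by exists (h * k); [exists k | rewrite mulgA].
Qed.

Lemma lcoset_inv g : N g ->
  [set x^-1 | x in lcoset g K] = lcoset g^-1 K.
Proof.
case: nKN => -[N1 NM NV] [K1 KM KV] KN nK Ng; apply/seteqP; split=> x /=.
- move=> [_ [k Kk <-] <-]; exists (g * k^-1 * g^-1).
    by apply: nK => //; apply: KV.
  by rewrite invgM !mulgA mulVg mul1g.
- move=> [k Kk <-]; exists (g * (g^-1 * k^-1 * g^-1^-1)).
    exists (g^-1 * k^-1 * g^-1^-1) => //.
    by apply: nK; [apply: NV | apply: KV].
  by rewrite !invgM !invgK !mulgA mulgK.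
Qed.

Fact quotient_one_subproof : exists2 g, N g & K = lcoset g K.
Proof.
case: nKN => -[N1 _ _] _ _ _; exists 1 => //; apply/seteqP; split=> x /=.
  by move=> Kx; exists x; rewrite ?mul1g.
by move=> [k Kk <-]; rewrite mul1g.
Qed.

Fact quotient_mul_subproof (C D : Q) :
  exists2 g, N g & set_mul C D = lcoset g K.
Proof.
case: C D => [C [g Ng EC]] [D [h Nh ED]] /=; rewrite EC ED; exists (g * h).
  by case: nKN => -[_ NM _] _ _ _; apply: NM.
exact: lcoset_mul.
Qed.

Fact quotient_inv_subproof (C : Q) :
  exists2 g, N g & [set x^-1 | x in coset_set C] = lcoset g K.
Proof.
case: C => [C [g Ng EC]] /=; rewrite EC; exists g^-1; last exact: lcoset_inv.
by case: nKN => -[_ _ NV] _ _ _; apply: NV.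
Qed.

Definition quotient_one : Q := Coset nKN quotient_one_subproof.
Definition quotient_mul (C D : Q) : Q := Coset nKN (quotient_mul_subproof C D).
Definition quotient_inv (C : Q) : Q := Coset nKN (quotient_inv_subproof C).

Fact quotient_mulA : associative quotient_mul.
Proof.
move=> C D E; apply: coset_inj; apply/seteqP; split=> x /=.
- move=> [c Cc [_ [d Dd [e Ee <-]] <-]]; exists (c * d); first by exists c => //; exists d.
  by exists e; rewrite ?mulgA.
- move=> [_ [c Cc [d Dd <-]] [e Ee <-]]; exists c => //.
  by exists (d * e); [exists d => //; exists e | rewrite mulgA].
Qed.

Fact quotient_mul1 : left_id quotient_one quotient_mul.
Proof.
have [[N1 NM NV] _ _ _] := nKN; move=> [C [g Ng PC]]; apply: coset_inj => /=.
rewrite PC; have -> : set_mul K (lcoset g K) = set_mul (lcoset 1 K) (lcoset g K).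
  by congr set_mul; apply/seteqP; split=> x /=;
    [exists x; rewrite ?mul1g | case=> k Kk <-; rewrite mul1g].
by rewrite lcoset_mul // mul1g.
Qed.

Fact quotient_mulV : left_inverse quotient_one quotient_inv quotient_mul.
Proof.
have [[N1 NM NV] _ _ _] := nKN; move=> [C [g Ng PC]]; apply: coset_inj => /=.
rewrite PC lcoset_inv // lcoset_mul ?mulVg //; last exact: NV.
by apply/seteqP; split=> x /=;
  [case=> k Kk <-; rewrite mul1g | exists x; rewrite ?mul1g].
Qed.

Fact quotient_mulr1 : right_id quotient_one quotient_mul.
Proof.
have [[N1 NM NV] _ _ _] := nKN; move=> [C [g Ng PC]]; apply: coset_inj => /=.
rewrite PC; have -> : set_mul (lcoset g K) K = set_mul (lcoset g K) (lcoset 1 K).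
  by congr set_mul; apply/seteqP; split=> x /=;
    [exists x; rewrite ?mul1g | case=> k Kk <-; rewrite mul1g].
by rewrite lcoset_mul // mulg1.
Qed.

Fact quotient_mulrV : right_inverse quotient_one quotient_inv quotient_mul.
Proof.
have [[N1 NM NV] _ _ _] := nKN; move=> [C [g Ng PC]]; apply: coset_inj => /=.
rewrite PC lcoset_inv // lcoset_mul ?mulgV //; last exact: NV.
by apply/seteqP; split=> x /=;
  [case=> k Kk <-; rewrite mul1g | exists x; rewrite ?mul1g].
Qed.

HB.instance Definition _ := isGroup.Build Q
  quotient_mulA quotient_mul1 quotient_mulr1 quotient_mulV quotient_mulrV.

End Quotient.

Definition group_isomorphic (G H : groupType) : Prop :=
  exists f : {multiplicative G -> H}, bijective f.

(** * Artin-Tits and Coxeter groups *)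

(* [None] encodes the label infinity. *)
Record coxeter_matrix (S : finType) := CoxeterMatrix {
  cox_label :> S -> S -> option nat;
  cox_sym : forall s t, cox_label s t = cox_label t s;
  cox_diag : forall s, cox_label s s = Some 1%N;
  cox_offdiag : forall s t n, s != t -> cox_label s t = Some n -> (2 <= n)%N }.

(* The alternating word [s t s ...] with [n] letters. *)
Fixpoint alt_word (S : Type) (s t : S) (n : nat) : word S :=
  if n is n'.+1 then (s, true) :: alt_word t s n' else [::].

Section ArtinTits.
Variables (S : finType) (M : coxeter_matrix S).

Inductive artin_rel : word S -> word S -> Prop :=
| ArtinBraid s t n : s != t -> M s t = Some n ->
    artin_rel (alt_word s t n) (alt_word t s n).

Inductive coxeter_rel : word S -> word S -> Prop :=
| CoxeterBraid u v : artin_rel u v -> coxeter_rel u v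
| CoxeterSquare s : coxeter_rel [:: (s, true); (s, true)] [::].

Definition artin_group : groupType := presented_group artin_rel.
Definition coxeter_group : groupType := presented_group coxeter_rel.

Definition artin_gen (s : S) : artin_group := pres_gen artin_rel s.
Definition coxeter_gen (s : S) : coxeter_group := pres_gen coxeter_rel s.

Definition spherical : Prop := finite_set [set: coxeter_group].

Variable X : {set S}.

Definition artin_parabolic : set artin_group :=
  generated (artin_gen @` [set` X]).
Definition coxeter_parabolic : set coxeter_group :=
  generated (coxeter_gen @` [set` X]).

Definition artin_centralizer : set artin_group :=
  [set g | forall s, s \in X -> g * artin_gen s = artin_gen s * g].

(* [g X] is contained in [A_X g]; only one inclusion is required. *)
Definition artin_normalizer : set artin_group :=
  [set g | forall s, s \in X ->
     exists2 h, artin_parabolic h & g * artin_gen s = h * g].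

End ArtinTits.

Arguments artin_parabolic {S} M X.
Arguments coxeter_parabolic {S} M X.
Arguments artin_centralizer {S} M X.
Arguments artin_normalizer {S} M X.

(* Main.v *)
Require Import Defs.
From HB Require Import structures.
From mathcomp Require Import all_boot all_algebra all_field.
From mathcomp Require Import ring zify.
From mathcomp Require Import boolp classical_sets cardinality.

(** Let N be the normalizer and Z the centralizer of a parabolic subgroup H, in the Artin group or
    in the Coxeter group. The quotient N / (Z H) is the image of N in the outer automorphism group
    of H. In both groups every element of N is a product of an element of H and an element q such that
    conjugation by q permutes X ([artin_normalizer_decomp], [coxeter_normalizer_decomp]), so the
    image consists of classes of permutations of X modulo those that are inner in H.

    The same permutations occur in both groups, and the same ones are inner. The projection of A
    to W preserves the permutation induced by q. Conversely let [artin_lift] be the set-theoretic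
    section sending w to the element of A given by any reduced word of w ([matsumoto]). If
    w s w^-1 = t for generators s and t, the lift of w conjugates s to t as well ([lift_conj]), and the
    lift maps W_X to A_X. Hence the projection induces the isomorphism
    ([normalizer_quotient_iso]).

    In the Coxeter group the decomposition of N is a comparison of lengths for a minimal coset
    representative. In the Artin group it is Garside theory. A power of the central element Delta^2
    makes g positive, and g = d q, where d has its letters in X and q has no left divisor in X. For s in X,
    q s = b q with b in A_X, and b = c^-1 e for positive words c and e in X. Then c q s = e q forces c to
    divide e ([Xfree_divisor]), so b is positive, and it is a generator because relations preserve
    the number of letters.

    Divisibility of positive words in A is controlled by one property: an element divisible on the
    left by s and by t is divisible by the alternating word of length m(s, t)
    ([wordA_two_divisors]). For its proof, words act on streams of elements of W as they act on
    greedy normal forms ([star]). The first entry of the stream of a positive word is its greatest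
    simple prefix, and in W two descents s and t produce an alternating prefix ([descents2]). The
    longest element acts on normal streams as the shift, hence injectively, so the action of a
    positive word depends only on its class in the group ([act_word_wcongr]).

    The properties of W come from its presentation: the geometric representation gives the orders
    of the products s t ([alt_word_order]), the parity of inversions gives the exchange condition
    ([exchange]), and a confluence argument gives greatest elements for the weak order
    ([weak_le_max]). *)

Set Implicit Arguments.
Unset Strict Implicit.
Unset Printing Implicit Defensive.

Local Open Scope quotient_scope.
Local Open Scope group_scope.

(** * Normalizers and generated subgroups *)

Section GroupGeneralities.
Variable G : groupType.
Implicit Types (H : set G) (g : G).

Lemma generated_subgroup (B : set G) : is_subgroup (generated B).
Proof.
split=> [H [[]]|x y Gx Gy H hH|x Gx H hH] //.
  by case: (hH) => -[_ HM _] _; apply: HM; [apply: Gx|apply: Gy].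
by case: (hH) => -[_ _ HV] _; apply: HV; apply: Gx.
Qed.

Lemma generated_ind (B : set G) (P : G -> Prop) :
  (forall x, B x -> P x) -> P 1 -> (forall x y, P x -> P y -> P (x * y)) ->
  (forall x, P x -> P x^-1) -> forall x, generated B x -> P x.
Proof. by move=> PB P1 PM PV x; apply; split; [split|]. Qed.

Lemma mem_generated (B : set G) x : B x -> generated B x.
Proof. by move=> Bx H [_]; apply. Qed.

Lemma normalizerP H g : normalizer H g <->
  (forall h, H h -> H (g * h * g^-1)) /\ (forall h, H h -> H (g^-1 * h * g)).
Proof.
split=> [E|[h1 h2]].
  split=> h Hh; first by rewrite -E; exists h.
  by move: Hh; rewrite -{1}E => -[k Hk <-]; rewrite !mulgA mulgVK mulVg mul1g.
apply/seteqP; split=> x /=; first by case=> h Hh <-; apply: h1.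
move=> Hx; exists (g^-1 * x * g); first exact: h2.
by rewrite !mulgA mulgK mulgV mul1g.
Qed.

Lemma normalizer_subgroup H : is_subgroup (normalizer H).
Proof.
split.
- by apply/normalizerP; split=> h Hh; rewrite ?invg1 mul1g mulg1.
- move=> x y /normalizerP[x1 x2] /normalizerP[y1 y2]; apply/normalizerP.
  split=> h Hh; rewrite invgM.
    by have := x1 _ (y1 _ Hh); rewrite !mulgA.
  by have := y2 _ (x2 _ Hh); rewrite !mulgA.
by move=> x /normalizerP[x1 x2]; apply/normalizerP; split=> h; rewrite invgK; auto.
Qed.

Lemma subgroup_normalizer H g : is_subgroup H -> H g -> normalizer H g.
Proof.
case=> _ HM HV Hg; apply/normalizerP.
by split=> h Hh; apply: (HM); auto.
Qed.

Lemma normal_centralizer_mul H : is_subgroup H ->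
  normal_in (set_mul (centralizer H) H) (normalizer H).
Proof.
move=> sH; have [H1 HM HV] := sH; have sN := normalizer_subgroup H.
have [N1 NM NV] := sN; have HN g := @subgroup_normalizer H g sH.
have CN c : centralizer H c -> normalizer H c.
  move=> Cc; apply/normalizerP; split=> h Hh; first by rewrite Cc // mulgK.
  by rewrite -mulgA -Cc // mulKg.
have CV c : centralizer H c -> centralizer H c^-1.
  by move=> Cc h Hh; apply: (mulgI c); rewrite mulVKg mulgA Cc // mulgK.
have CM c d : centralizer H c -> centralizer H d -> centralizer H (c * d).
  by move=> Cc Cd h Hh; rewrite -mulgA Cd // !mulgA Cc.
split=> //.
- split; first by exists 1; [by move=> h _; rewrite mul1g mulg1|exists 1; rewrite ?mulg1].
  + move=> _ _ [c Cc [x Hx <-]] [d Cd [y Hy <-]].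
    exists (c * d); first by apply: CM.
    exists (x * y); first by apply: HM.
    by rewrite -!mulgA (mulgA d) (Cd x Hx) !mulgA.
  + move=> _ [c Cc [x Hx <-]]; exists c^-1; first by apply: CV.
    by exists x^-1; [exact: HV | rewrite Cc // invgM].
- by move=> _ [c Cc [x Hx <-]]; apply: NM; auto.
move=> g _ Ng [c Cc [x Hx <-]]; have /normalizerP[g1 g2] := Ng.
exists (g * c * g^-1).
  move=> h Hh; have := Cc _ (g2 _ Hh).
  move=> /(congr1 (fun y => g * y * g^-1)).
  by rewrite !mulgA mulgV mul1g mulgK.
by exists (g * x * g^-1); [exact: g1 | rewrite !mulgA mulgVK].
Qed.

(** Conjugation by g is injective on the finite set X, so it permutes X, and the inverse of g
    conjugates X into X as well. *)
Lemma permuting_normalizer (S : finType) (f : S -> G) (X : {set S}) g :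
  injective f ->
  (forall s, s \in X -> exists2 t, t \in X & g * f s = f t * g) ->
  normalizer (generated [set f x | x in [set` X]]%classic) g.
Proof.
move=> finj gX; set H := generated _.
have [H1 HM HV] := generated_subgroup [set f x | x in [set` X]]%classic.
have [sg sgP] : {sg : S -> S & forall s, s \in X -> sg s \in X /\ g * f s = f (sg s) * g}.
  apply: (@choice S S (fun s t => s \in X -> t \in X /\ g * f s = f t * g)) => s.
  case Xs: (s \in X); last by exists s.
  by have [t Xt E] := gX s Xs; exists t.
have sg_inj : {in X &, injective sg}.
  move=> s t Xs Xt E; apply: finj; apply: (mulgI g).
  by have [_ ->] := sgP s Xs; have [_ ->] := sgP t Xt; rewrite E.
have sg_onto t : t \in X -> exists2 s, s \in X & sg s = t.
  have /eqP EX : [set sg s | s in X] == X.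
    rewrite eqEcard card_in_imset // leqnn andbT.
    by apply/fintype.subsetP => _ /imsetP[s Xs ->]; have [] := sgP s Xs.
  by rewrite -{1}EX => /imsetP[s Xs ->]; exists s.
apply/normalizerP; split=> h.
  apply: (@generated_ind _ (fun h => H (g * h * g^-1))).
  - move=> _ [s Xs <-]; have [Xt ->] := sgP s Xs; rewrite mulgK.
    by apply: mem_generated; exists (sg s).
  - by rewrite mulg1 mulgV.
  - by move=> x y Hx Hy; have := HM _ _ Hx Hy; rewrite !mulgA mulgVK.
  - by move=> x Hx; have := HV _ Hx; rewrite !invgM invgK !mulgA.
apply: (@generated_ind _ (fun h => H (g^-1 * h * g))).
- move=> _ [t Xt <-]; have [s Xs <-] := sg_onto t Xt.
  have [_ E] := sgP s Xs; rewrite -mulgA -E mulKg.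
  by apply: mem_generated; exists s.
- by rewrite mulg1 mulVg.
- by move=> x y Hx Hy; have := HM _ _ Hx Hy; rewrite !mulgA mulgK.
- by move=> x Hx; have := HV _ Hx; rewrite !invgM invgK !mulgA.
Qed.
End GroupGeneralities.

(** * Isomorphisms between quotients *)

Section QuotientIso.
Variables (G G' : groupType) (K N : set G) (K' N' : set G').
Variables (nKN : normal_in K N) (nKN' : normal_in K' N') (phi : G -> G').
Hypothesis phiM : forall x y, phi (x * y) = phi x * phi y.
Hypothesis phiN : forall g, N g -> N' (phi g).
Hypothesis phiK : forall g, N g -> K' (phi g) <-> K g.
Hypothesis phi_onto : forall h, N' h -> exists2 g, N g & K' (h^-1 * phi g).

Lemma lcoset_eq (H : groupType) (L : set H) x y :
  is_subgroup L -> lcoset x L = lcoset y L <-> L (x^-1 * y).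
Proof.
case=> L1 LM LV; split=> [E|Lxy].
  have : lcoset x L y by rewrite E; exists 1; rewrite ?mulg1.
  by case=> l Ll <-; rewrite mulKg.
apply/seteqP; split=> z /= [l Ll <-].
  exists (y^-1 * x * l); last by rewrite !mulgA mulgV mul1g.
  by apply: LM => //; have := LV _ Lxy; rewrite invgM invgK.
by exists (x^-1 * y * l); [exact: LM | rewrite !mulgA mulgV mul1g].
Qed.

(** The induced map is well defined and injective because phi detects membership in K on N,
    and surjective because phi N meets every coset of K' in N'. *)
Lemma quotient_iso : group_isomorphic (quotient_group nKN) (quotient_group nKN').
Proof.
have [sN sK KN _] := nKN; have [sN' sK' KN' _] := nKN'.
have [N1 NM NV] := sN; have [N1' NM' NV'] := sN'.
have phi1 : phi 1 = 1 by apply: (mulgI (phi 1)); rewrite -phiM !mulg1.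
have phiV x : phi x^-1 = (phi x)^-1.
  by apply/esym/mulg1_eq; rewrite -phiM mulgV.
have F_ex (C : quotient_group nKN) :
    exists D : quotient_group nKN', exists2 g, N g &
      coset_set C = lcoset g K /\ coset_set D = lcoset (phi g) K'.
  have [g Ng Cg] := cosetP C.
  by exists (Coset nKN' (ex_intro2 _ _ (phi g) (phiN Ng) erefl)); exists g.
have [F FP] := choice F_ex.
have FE C g : N g -> coset_set C = lcoset g K -> coset_set (F C) = lcoset (phi g) K'.
  move=> Ng Cg; have [h Nh [Ch ->]] := FP C.
  apply/(lcoset_eq _ _ sK'); rewrite -phiV -phiM phiK; last by apply: NM => //; apply: NV.
  by apply/(lcoset_eq _ _ sK); rewrite -Ch.
have FM : {morph F : x y / x * y}.
  move=> C D; have [g Ng Cg] := cosetP C; have [h Nh Dh] := cosetP D.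
  apply: coset_inj; rewrite (FE _ (g * h)) ?phiM; last 2 first.
  - exact: NM.
  - by rewrite -(lcoset_mul nKN Ng Nh) -Cg -Dh.
  by rewrite -(lcoset_mul nKN' (phiN Ng) (phiN Nh)) -(FE _ _ Ng Cg) -(FE _ _ Nh Dh).
pose Fm : {multiplicative quotient_group nKN -> quotient_group nKN'} :=
  HB.pack F (isMultiplicative.Build _ _ F FM).
exists Fm.
have Finj : injective F.
  move=> C D; have [g Ng Cg] := cosetP C; have [h Nh Dh] := cosetP D.
  move=> /(congr1 (@coset_set _ _ _ _)); rewrite (FE _ _ Ng Cg) (FE _ _ Nh Dh).
  move=> /(lcoset_eq _ _ sK'); rewrite -phiV -phiM phiK; last by apply: NM => //; apply: NV.
  by move=> /(lcoset_eq _ _ sK) E; apply: coset_inj; rewrite Cg Dh.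
have [F' F'P] : {F' & forall D, F (F' D) = D}.
  apply: (@choice _ _ (fun D C => F C = D)) => D.
  have [h Nh Dh] := cosetP D; have [g Ng hg] := phi_onto Nh.
  exists (Coset nKN (ex_intro2 _ _ g Ng erefl)); apply: coset_inj.
  rewrite (FE _ g Ng) // Dh; apply/esym.
  exact/(lcoset_eq _ _ sK').
by exists F' => [C|D] /=; [apply: Finj; rewrite F'P | exact: F'P].
Qed.
End QuotientIso.

(** * The geometric representation *)

(** A presented group acts as soon as inverse letters cancel and the relators act equally.
    This is how every invariant of words below is shown to depend on the group element only. *)
Lemma wcongr_foldl (S : choiceType) (R : word S -> word S -> Prop) (T : Type)
    (act : T -> S * bool -> T) :
    (forall x s b, act (act x (s, b)) (s, ~~ b) = x) ->
    (forall u v, R u v -> forall x, foldl act x u = foldl act x v) ->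
  forall u v, wcongr R u v -> forall x, foldl act x u = foldl act x v.
Proof.
move=> actK actR u v; elim=> {u v} //.
- by move=> u v w _ IHu _ IHv x; rewrite IHu.
- by move=> u u' v v' _ IHu _ IHv x; rewrite !foldl_cat IHu IHv.
- by move=> s b x /=; rewrite actK.
Qed.

Section GeometricRepresentation.
Variables (S : finType) (M : coxeter_matrix S).
Import GRing.Theory Num.Theory.
Local Open Scope ring_scope.

(** A number z with -(z + 1/z) as the off-diagonal entry of the bilinear form: a primitive
    2m-th root of unity gives -2 cos(pi/m) up to Galois conjugation, which keeps the orders of
    products of two reflections, and z = 2 gives infinite order. *)
Definition zlabel (o : option nat) : algC :=
  if o is Some m.+1 then sval (C_prim_root_exists (ltn0Sn m.*2.+1)) else 2%:R.

Lemma zlabelP s t : s != t ->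
  let z := zlabel (M s t) in
  [/\ z != 0, z - z^-1 != 0 &
      if M s t is Some m then (2 * m).-primitive_root z
      else forall k, z ^+ k = 1 -> k = 0%N].
Proof.
move=> st; have off := @cox_offdiag _ M s t; case E: (M s t) => [m|] /=.
- have := off m st E; case: m E => // m E m_gt /=.
  case: C_prim_root_exists => z /= zP.
  have z0 : z != 0.
    apply/eqP => z0; have := prim_expr_order zP.
    by rewrite z0 expr0n /= => /eqP; rewrite eq_sym oner_eq0.
  split=> //; last by rewrite mul2n.
  rewrite subr_eq0; apply/eqP => zV; have : z ^+ 2 = 1.
    by rewrite expr2 {1}zV mulVf.
  move/eqP; rewrite -(prim_order_dvd zP) => /dvdn_leq; lia.
- have H2 : (2%:R : algC) != 0 by rewrite pnatr_eq0.
  split=> //.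
    rewrite subr_eq0; apply/eqP => /(congr1 ( *%R 2%:R)); rewrite mulfV // -natrM.
    by move/eqP; rewrite pnatr_eq1.
  by move=> k; rewrite -natrX => /eqP; rewrite pnatr_eq1; case: k => // k; rewrite expnS; lia.
Qed.

Definition cform (s t : S) : algC :=
  if s == t then 2%:R else - (zlabel (M s t) + (zlabel (M s t))^-1).

Lemma cformC s t : cform s t = cform t s.
Proof. by rewrite /cform eq_sym cox_sym. Qed.

Lemma cform_diag s : cform s s = 2%:R. Proof. by rewrite /cform eqxx. Qed.

(** The dual of the geometric representation: a linear form is recorded by its values on the
    simple roots, so that no sum over S appears. *)
Definition refl_act (f : S -> algC) (l : S * bool) : S -> algC :=
  fun r => f r - cform l.1 r * f l.1.

Lemma refl_actK f s b : refl_act (refl_act f (s, b)) (s, ~~ b) = f.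
Proof. by apply/funext => r; rewrite /refl_act /= cform_diag; ring. Qed.

(** The Chebyshev-type sequence governing the orbit of a pair of reflections, with indices
    shifted by one: term n is (z^(n-1) - z^(1-n)) / (z - 1/z) for c = -(z + 1/z) (lemma chebE). *)
Fixpoint cheb (c : algC) n : algC :=
  if n is n1.+1 then
    if n1 is n2.+1 then - c * cheb c n1 - cheb c n2 else 0
  else - 1.
Arguments cheb : simpl never.

Lemma cheb0 c : cheb c 0 = -1. Proof. by []. Qed.
Lemma cheb1 c : cheb c 1 = 0. Proof. by []. Qed.
Lemma chebSS c n : cheb c n.+2 = - c * cheb c n.+1 - cheb c n. Proof. by []. Qed.

Lemma chebE z n : z != 0 ->
  (z - z^-1) * cheb (- (z + z^-1)) n = z ^+ n / z - z / z ^+ n.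
Proof.
move=> z0; suff: (z - z^-1) * cheb (- (z + z^-1)) n = z ^+ n / z - z / z ^+ n /\
  (z - z^-1) * cheb (- (z + z^-1)) n.+1 = z ^+ n.+1 / z - z / z ^+ n.+1 by case.
have zn k : z ^+ k != 0 by rewrite expf_neq0.
elim: n => [|n [IH1 IH2]]; first by split; rewrite ?cheb0 ?cheb1 ?expr0 ?expr1; field.
split=> //; rewrite chebSS opprK.
rewrite mulrBr mulrCA IH1 IH2 !exprS; field.
by rewrite zn z0.
Qed.

(** Applying reflections s and t only changes a form by multiples of the two corresponding
    columns of the bilinear form. *)
Lemma foldl_alt_span n s t f : exists a b, forall r,
  foldl refl_act f (alt_word s t n) r = f r - a * cform s r - b * cform t r.
Proof.
elim: n s t f => [|n IH] s t f /=; first by exists 0, 0 => r; ring.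
have [a [b H]] := IH t s (refl_act f (s, true)).
exists (b + f s), a => r; rewrite H /refl_act /=; ring.
Qed.

Lemma foldl_alt_val n s t f : s != t -> let c := cform s t in
  foldl refl_act f (alt_word s t n) (if odd n then t else s) =
    cheb c n.+2 * f s + cheb c n.+1 * f t /\
  foldl refl_act f (alt_word s t n) (if odd n then s else t) =
    - (cheb c n.+1 * f s + cheb c n * f t).
Proof.
move=> st c; elim: n s t f st @c => [|n IH] s t f st c.
  by rewrite /= chebSS cheb0 cheb1; split; ring.
have ts : t != s by rewrite eq_sym.
have [H1 H2] := IH t s (refl_act f (s, true)) ts.
rewrite (cformC t s) -/c /refl_act /= cform_diag (_ : cform s t = c) // in H1 H2 *.
by rewrite !if_neg H1 H2 (chebSS _ n.+1) (chebSS _ n); split; ring.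
Qed.

Lemma cheb_zlabel s t n : s != t -> let z := zlabel (M s t) in
  (z - z^-1) * cheb (cform s t) n = z ^+ n / z - z / z ^+ n.
Proof.
move=> st z; have [z0 _ _] := zlabelP st.
by rewrite /cform (negbTE st) chebE.
Qed.

(** The two alternating products of length m agree at s and t by the values of the Chebyshev
    sequence. They then agree everywhere, since their difference is a combination of two columns
    whose restriction to s and t has determinant 4 - c^2, which is not zero. *)
Lemma refl_act_braid u v : artin_rel M u v ->
  forall f, foldl refl_act f u = foldl refl_act f v.
Proof.
case=> s t m st Mst f.
have ts : t != s by rewrite eq_sym.
have := zlabelP st; rewrite /= Mst.
set z := zlabel _ => -[z0 zz0 zP].
(* z^m is a square root of 1 other than 1. *)
have zm : z ^+ m = -1.
  have m2 : (m < 2 * m)%N by have := cox_offdiag st Mst; lia.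
  have /eqP : (z ^+ m) ^+ 2 = 1 by rewrite -exprM mulnC (prim_expr_order zP).
  rewrite sqrf_eq1 => /orP[|/eqP //]; rewrite -(prim_order_dvd zP) => /dvdn_leq; lia.
have E n := cheb_zlabel n st; rewrite /= Mst -/z in E.
have q0 : cheb (cform s t) m.+1 = 0.
  by apply: (mulfI zz0); rewrite E exprS zm; field.
have q1 : cheb (cform s t) m.+2 = -1.
  by apply: (mulfI zz0); rewrite E !exprS zm; field.
have q2 : cheb (cform s t) m = 1.
  by apply: (mulfI zz0); rewrite E zm; field.
have [H1 H2] := foldl_alt_val m f st; have [H3 H4] := foldl_alt_val m f ts.
rewrite /= (cformC t s) q0 q1 q2 in H1 H2 H3 H4.
have [a [b Hab]] := foldl_alt_span m s t f.
have [a' [b' Hab']] := foldl_alt_span m t s f.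
have Hs : foldl refl_act f (alt_word s t m) s = foldl refl_act f (alt_word t s m) s.
  by move: H1 H2 H3 H4; case: (odd m) => h1 h2 h3 h4; rewrite ?h1 ?h2 ?h3 ?h4; ring.
have Ht : foldl refl_act f (alt_word s t m) t = foldl refl_act f (alt_word t s m) t.
  by move: H1 H2 H3 H4; case: (odd m) => h1 h2 h3 h4; rewrite ?h1 ?h2 ?h3 ?h4; ring.
rewrite !Hab !Hab' !cform_diag (cformC t s) in Hs Ht.
set c := cform s t in Hs Ht.
have c4 : c ^+ 2 - 4%:R != 0.
  rewrite /c /cform (negbTE st) Mst -/z.
  have -> : (- (z + z^-1)) ^+ 2 - 4%:R = (z - z^-1) ^+ 2 by field.
  by rewrite sqrf_eq0.
(* Cramer's rule for the restriction to s and t. *)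
have Ea : (c ^+ 2 - 4%:R) * (a - b') = 0.
  have -> : (c ^+ 2 - 4%:R) * (a - b') =
     2%:R * ((f s - a * 2%:R - b * c) - (f s - a' * c - b' * 2%:R)) -
     c * ((f t - a * c - b * 2%:R) - (f t - a' * 2%:R - b' * c)) by ring.
  by rewrite Hs Ht; ring.
have Eb : (c ^+ 2 - 4%:R) * (b - a') = 0.
  have -> : (c ^+ 2 - 4%:R) * (b - a') =
     2%:R * ((f t - a * c - b * 2%:R) - (f t - a' * 2%:R - b' * c)) -
     c * ((f s - a * 2%:R - b * c) - (f s - a' * c - b' * 2%:R)) by ring.
  by rewrite Hs Ht; ring.
move/eqP: Ea; rewrite mulf_eq0 (negbTE c4) subr_eq0 => /eqP Ea.
move/eqP: Eb; rewrite mulf_eq0 (negbTE c4) subr_eq0 => /eqP Eb.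
by apply/funext => r; rewrite Hab Hab' Ea Eb; ring.
Qed.

Lemma refl_act_coxeter u v : wcongr (coxeter_rel M) u v ->
  forall f, foldl refl_act f u = foldl refl_act f v.
Proof.
apply: wcongr_foldl; first exact: refl_actK.
move=> {}u {}v [{}u {}v /refl_act_braid //|s f /=].
exact: (refl_actK f s true).
Qed.

(** The order of s t is the label itself, not a proper divisor of it: if (s t)^k fixes the two
    forms equal to 1 at one of s, t and to 0 elsewhere, then z^(2k) = 1. *)
Lemma alt_word_order s t k : s != t ->
    wcongr (coxeter_rel M) (alt_word s t k.*2) [::] ->
  if M s t is Some m then (m %| k)%N else k == 0%N.
Proof.
move=> st /refl_act_coxeter H.
have := zlabelP st; rewrite /=; set z := zlabel _ => -[z0 zz0 zP].
pose f (a b : algC) : S -> algC := fun r => if r == s then a else if r == t then b else 0.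
have fs a b : f a b s = a by rewrite /f eqxx.
have ft a b : f a b t = b by rewrite /f eq_sym (negbTE st) eqxx.
have [H1 _] := foldl_alt_val k.*2 (f 1 0) st.
have [H2 _] := foldl_alt_val k.*2 (f 0 1) st.
rewrite /= odd_double H /= !fs !ft ?(mulr1, mulr0, addr0, add0r) in H1.
rewrite /= odd_double H /= !fs !ft ?(mulr1, mulr0, addr0, add0r) in H2.
have E n := cheb_zlabel n st; rewrite /= -/z in E.
have zn i : z ^+ i != 0 by rewrite expf_neq0.
have E1 := E k.*2.+2; have E2 := E k.*2.+1.
rewrite -H1 in E1; rewrite -H2 mulr0 in E2.
have Z1 : z ^+ k.*2 = (z ^+ k.*2)^-1.
  apply/eqP; rewrite -subr_eq0; apply/eqP; rewrite [RHS]E2 exprS; field.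
  by rewrite zn z0.
have Zk : z ^+ k.*2 = 1.
  apply: (mulfI zz0); rewrite mulr1 -[RHS]mulr1 E1 !exprS.
  rewrite [RHS](_ : _ = z * z ^+ k.*2 - z^-1 * (z ^+ k.*2)^-1); last first.
    by field; rewrite zn z0.
  by rewrite -Z1 mulrBl.
case: (M s t) zP => [m|] zP; last by have := zP _ Zk; case: (k).
by move/eqP: Zk; rewrite -(prim_order_dvd zP) -mul2n dvdn_pmul2l.
Qed.
End GeometricRepresentation.

(** * Words in the generators *)

Section Words.
Variables (S : finType) (M : coxeter_matrix S).
Local Notation W := (coxeter_group M).
Local Notation r := (coxeter_gen M).
Local Notation A := (artin_group M).
Local Notation a := (artin_gen M).

Definition posword (u : seq S) : word S := [seq (s, true) | s <- u].
Definition wordW (u : seq S) : W := class_of_word (coxeter_rel M) (posword u).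
Definition wordA (u : seq S) : A := class_of_word (artin_rel M) (posword u).

Fixpoint alt (s t : S) n : seq S := if n is n'.+1 then s :: alt t s n' else [::].

Lemma posword_alt s t n : posword (alt s t n) = alt_word s t n.
Proof. by elim: n s t => //= n IH s t; rewrite -IH. Qed.

Lemma size_alt s t n : size (alt s t n) = n.
Proof. by elim: n s t => //= n IH s t; rewrite IH. Qed.

Lemma alt_rcons s t n : alt s t n.+1 = rcons (alt s t n) (if odd n then t else s).
Proof.
elim: n s t => // n IH s t.
by rewrite -[alt s t n.+2]/(s :: alt t s n.+1) IH /= if_neg.
Qed.

Lemma all_alt (X : {set S}) s t n : s \in X -> t \in X -> all (mem X) (alt s t n).
Proof. by elim: n s t => //= n IH s t Xs Xt; rewrite Xs IH. Qed.

Lemma class_of_cat (R : word S -> word S -> Prop) u v :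
  class_of_word R (u ++ v) = class_of_word R u * class_of_word R v.
Proof. by rewrite -pres_mulE. Qed.

Lemma wordW0 : wordW [::] = 1. Proof. by []. Qed.
Lemma wordA0 : wordA [::] = 1. Proof. by []. Qed.
Lemma wordW1 s : wordW [:: s] = r s. Proof. by []. Qed.
Lemma wordA1 s : wordA [:: s] = a s. Proof. by []. Qed.

Lemma wordW_cat u v : wordW (u ++ v) = wordW u * wordW v.
Proof. by rewrite /wordW /posword map_cat class_of_cat. Qed.

Lemma wordA_cat u v : wordA (u ++ v) = wordA u * wordA v.
Proof. by rewrite /wordA /posword map_cat class_of_cat. Qed.

Lemma wordW_cons s u : wordW (s :: u) = r s * wordW u.
Proof. exact: (wordW_cat [:: s] u). Qed.

Lemma wordA_cons s u : wordA (s :: u) = a s * wordA u.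
Proof. exact: (wordA_cat [:: s] u). Qed.

Lemma gen_sq s : r s * r s = 1.
Proof. by rewrite -class_of_cat; apply/class_of_wordP/wcongr_rel; apply: CoxeterSquare. Qed.

Lemma genV s : (r s)^-1 = r s.
Proof. exact/mulg1_eq/gen_sq. Qed.

Lemma genKl s w : r s * (r s * w) = w. Proof. by rewrite mulgA gen_sq mul1g. Qed.
Lemma genKr s w : w * r s * r s = w. Proof. by rewrite -mulgA gen_sq mulg1. Qed.

Lemma class_letterV (R : word S -> word S -> Prop) s :
  class_of_word R [:: (s, false)] = (class_of_word R [:: (s, true)])^-1.
Proof.
by symmetry; apply: mulg1_eq; rewrite -class_of_cat; apply/class_of_wordP/wcongr_cancel.
Qed.

Lemma wordW_rev u : wordW (rev u) = (wordW u)^-1.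
Proof.
elim: u => [|s u IH]; first by rewrite wordW0 invg1.
by rewrite rev_cons -cats1 wordW_cat IH wordW1 wordW_cons invgM genV.
Qed.

Lemma wordW_surj w : exists u, wordW u = w.
Proof.
rewrite -[w]class_of_repr; elim: (repr _) => [|[s b] v [u uv]]; first by exists [::].
exists (s :: u); rewrite wordW_cons uv -cat1s class_of_cat; congr (_ * _).
by case: b; rewrite // class_letterV; apply: esym; apply: genV.
Qed.

Lemma wordA_braid s t m : s != t -> M s t = Some m -> wordA (alt s t m) = wordA (alt t s m).
Proof.
by move=> st Mst; apply/class_of_wordP; rewrite !posword_alt; apply/wcongr_rel/ArtinBraid.
Qed.

Lemma wordW_braid s t m : s != t -> M s t = Some m -> wordW (alt s t m) = wordW (alt t s m).
Proof.
move=> st Mst; apply/class_of_wordP; rewrite !posword_alt.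
exact/wcongr_rel/CoxeterBraid/ArtinBraid.
Qed.

(** * Inversion parity *)

Lemma alt_shift s t i j :
  wordW (alt s t i.+1) = wordW (alt t s j) -> wordW (alt t s i) = wordW (alt s t j.+1).
Proof. by rewrite /= !wordW_cons => <-; rewrite genKl. Qed.

Lemma alt_shiftV s t i j :
  wordW (alt s t i) = wordW (alt t s j.+1) -> wordW (alt t s i.+1) = wordW (alt s t j).
Proof. by rewrite /= !wordW_cons => ->; rewrite genKl. Qed.

(** Moving letters one at a time across the braid relation keeps the total length 2m. *)
Lemma alt_balance s t m i : s != t -> M s t = Some m -> i <= m.*2 ->
  wordW (alt s t i) = wordW (alt t s (m.*2 - i)).
Proof.
move=> st Mst; have E := wordW_braid st Mst.
suff H k : k <= m ->
    (wordW (alt s t (m - k)) = wordW (alt t s (m + k)) /\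
     wordW (alt t s (m - k)) = wordW (alt s t (m + k))).
  move=> im; case: (leqP i m) => mi.
    have [|h _] := H (m - i); first by lia.
    by move: h; congr (wordW (alt _ _ _) = wordW (alt _ _ _)); lia.
  have [|_ h] := H (i - m); first by lia.
  by move: (esym h); congr (wordW (alt _ _ _) = wordW (alt _ _ _)); lia.
elim: k => [|k IH] km; first by rewrite subn0 addn0.
have [h1 h2] := IH (ltnW km).
rewrite -(subnSK km) in h1 h2.
by rewrite addnS; split; apply: alt_shift.
Qed.

(** The parity of the number of occurrences of x among the reflections
    s_1 ... s_(i-1) s_i s_(i-1) ... s_1 attached to the word u = s_1 ... s_n. *)
Fixpoint inv_par (u : seq S) (x : W) : bool :=
  if u is s :: u' then (x == r s) (+) inv_par u' (r s * x * r s) else false.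

(** The reflections attached to an alternating word are the alternating words of odd length. *)
Lemma inv_par_alt s t n x :
  inv_par (alt s t n) x = \big[addb/false]_(i < n) (x == wordW (alt s t i.*2.+1)).
Proof.
elim: n s t x => [|n IH] s t x; first by rewrite big_ord0.
rewrite big_ord_recl /= IH; congr (_ (+) _).
apply: eq_bigr => i _; rewrite -[_ :: _]/(s :: alt t s i.*2.+2).
rewrite (alt_rcons t s i.*2.+1) -cats1 wordW_cons wordW_cat wordW1 [odd _]/= odd_double.
apply/eqP/eqP => [<-|->]; first by rewrite !mulgA gen_sq mul1g genKr.
by rewrite !mulgA gen_sq mul1g genKr.
Qed.

Lemma inv_par_braid s t m x : s != t -> M s t = Some m ->
  inv_par (alt s t m) x = inv_par (alt t s m) x.
Proof.
move=> st Mst; rewrite !inv_par_alt [RHS](reindex_inj rev_ord_inj).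
apply: eq_bigr => i _; rewrite (alt_balance st Mst).
  by congr (_ == wordW (alt _ _ _)); have /= := ltn_ord i; rewrite /rev_ord /=; lia.
by have /= := ltn_ord i; lia.
Qed.

(** Bourbaki's action of the generators on reflections with a sign, extended to all of W. *)
Definition inv_act (x : W * bool) (l : S * bool) : W * bool :=
  (r l.1 * x.1 * r l.1, x.2 (+) (x.1 == r l.1)).

Lemma foldl_inv_act u x b :
  foldl inv_act (x, b) (posword u) = ((wordW u)^-1 * x * wordW u, b (+) inv_par u x).
Proof.
elim: u x b => [|s u IH] x b /=; first by rewrite wordW0 invg1 mul1g mulg1 addbF.
by rewrite IH wordW_cons invgM genV !mulgA addbA.
Qed.

Lemma inv_actK x s b : inv_act (inv_act x (s, b)) (s, ~~ b) = x.
Proof.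
case: x => x c; rewrite /inv_act /=; congr (_, _); first by rewrite !mulgA gen_sq mul1g genKr.
have -> : (r s * x * r s == r s) = (x == r s).
  apply/eqP/eqP => [h|->]; last by rewrite -mulgA gen_sq mulg1.
  by rewrite -[x](genKl s) -[r s * x](genKr s) h gen_sq mulg1.
by rewrite -addbA addbb addbF.
Qed.

Lemma inv_par_eq u v x : wordW u = wordW v -> inv_par u x = inv_par v x.
Proof.
move=> /class_of_wordP uv.
have : foldl inv_act (x, false) (posword u) = foldl inv_act (x, false) (posword v).
  move: uv (x, false); apply: wcongr_foldl; first exact: inv_actK.
  move=> _ _ [_ _ [s t m st Mst] [y b]|s y].
    rewrite -!posword_alt !foldl_inv_act (inv_par_braid _ st Mst).
    by rewrite (wordW_braid st Mst).
  exact: (inv_actK y s true).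
by rewrite !foldl_inv_act => -[].
Qed.

(** An odd count is positive, so x is the reflection attached to some letter, and multiplying
    by that reflection deletes the letter. *)
Lemma inv_par_delete u s : inv_par u (r s) ->
  exists u1 t u2, u = u1 ++ t :: u2 /\ r s * wordW u = wordW (u1 ++ u2).
Proof.
suff H x : inv_par u x -> exists u1 t u2, u = u1 ++ t :: u2 /\ x * wordW u = wordW (u1 ++ u2).
  exact: H.
elim: u x => //= t u IH x.
have [-> _|_ /= /IH [u1 [t' [u2 [-> E]]]]] := eqVneq x (r t).
  by exists [::], t, u; rewrite wordW_cons genKl.
exists (t :: u1), t', u2; split=> //; rewrite /= !wordW_cons -E.
by rewrite !mulgA gen_sq mul1g.
Qed.

(** * Length and exchange *)

Lemma has_length w : exists n, `[< exists2 u, size u = n & wordW u = w >].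
Proof. by have [u uw] := wordW_surj w; exists (size u); apply/asboolP; exists u. Qed.

Definition len (w : W) : nat := ex_minn (has_length w).

Lemma reduced_word w : exists2 u, size u = len w & wordW u = w.
Proof. by rewrite /len; case: ex_minnP => n /asboolP. Qed.

Lemma len_wordW u : len (wordW u) <= size u.
Proof.
by rewrite /len; case: ex_minnP => n _; apply; apply/asboolP; exists u.
Qed.

Lemma len1 : len 1 = 0.
Proof. by apply/eqP; rewrite -leqn0; apply: (len_wordW [::]). Qed.

Lemma len_eq0 w : (len w == 0) = (w == 1).
Proof.
apply/eqP/eqP => [w0|->]; last exact: len1.
by have [u] := reduced_word w; rewrite w0 => /size0nil ->.
Qed.

Lemma lenV w : len w^-1 = len w.
Proof.
suff H x : len x^-1 <= len x by apply/eqP; rewrite eqn_leq H -{1}[w]invgK H.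
have [u <- {1}<-] := reduced_word x; rewrite -wordW_rev -size_rev; exact: len_wordW.
Qed.

Lemma lenM x y : len (x * y) <= len x + len y.
Proof.
have [u <- {1}<-] := reduced_word x; have [v <- {1}<-] := reduced_word y.
by rewrite -wordW_cat -size_cat len_wordW.
Qed.

(** Since s inverts itself, exactly one of w and s w has odd inversion parity at s. It is the
    longer one, by deletion in a reduced word, and then deletion applies to any word of w. *)
Lemma exchange s u : len (r s * wordW u) < len (wordW u) ->
  exists u1 t u2, u = u1 ++ t :: u2 /\ r s * wordW u = wordW (u1 ++ u2).
Proof.
move=> lt; apply: inv_par_delete; apply: contraLR lt => Nu; rewrite -leqNgt.
have [v sv vE] := reduced_word (r s * wordW u).
have vN : inv_par v (r s).
  rewrite (@inv_par_eq v (s :: u)) ?wordW_cons // /= eqxx gen_sq mul1g.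
  by rewrite (negbTE Nu).
have [v1 [t [v2 [E1 E2]]]] := inv_par_delete vN.
rewrite vE genKl in E2; rewrite {1}E2; apply: leq_trans (len_wordW _) _.
by rewrite -sv E1 !size_cat /=; lia.
Qed.

Lemma len_neq s w : len (r s * w) != len w.
Proof.
have [u uw] := wordW_surj w.
have inv_lt v : inv_par v (r s) -> len (r s * wordW v) < len (wordW v).
  have [v' sv' E] := reduced_word (wordW v).
  rewrite -(inv_par_eq _ E) => /inv_par_delete [v1 [t [v2 [E1 E2]]]].
  rewrite -E E2 E -sv' E1; apply: leq_ltn_trans (len_wordW _) _.
  by rewrite !size_cat /=; lia.
case E: (inv_par u (r s)); first by have := inv_lt u E; rewrite uw; lia.
have := inv_lt (s :: u); rewrite /= eqxx gen_sq mul1g E => /(_ isT).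
by rewrite wordW_cons genKl uw; lia.
Qed.

Lemma len_r s : len (r s) = 1%N.
Proof.
have := len_neq s 1; rewrite mulg1 len1 -lt0n => h.
by apply/eqP; rewrite eqn_leq h andbT; apply: (len_wordW [:: s]).
Qed.

Lemma len_rl s w : len (r s * w) = (len w).+1 \/ len w = (len (r s * w)).+1.
Proof.
have := lenM (r s) w; have := lenM (r s) (r s * w).
by rewrite genKl len_r; have := len_neq s w; lia.
Qed.

Lemma len_rr s w : len (w * r s) = (len w).+1 \/ len w = (len (w * r s)).+1.
Proof.
have := len_rl s w^-1.
by rewrite lenV -[r s * _]invgK invgM invgK genV lenV.
Qed.

(** * Parabolic cosets *)

Section Parabolic.
Variable X : {set S}.
Local Notation WX := (coxeter_parabolic M X).

Lemma wordW_parabolic u : all (mem X) u -> WX (wordW u).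
Proof.
move=> Xu H [[H1 HM _] XH]; elim: u Xu => [|s u IH] //= /andP[Xs /IH Hu].
by rewrite wordW_cons; apply: HM => //; apply: XH; exists s.
Qed.

Lemma gen_parabolic s : s \in X -> WX (r s).
Proof. by move=> Xs; apply: mem_generated; exists s. Qed.

Lemma parabolic_subgroup : is_subgroup WX.
Proof. exact: generated_subgroup. Qed.

Lemma parabolicP w : WX w <-> exists2 u, all (mem X) u & wordW u = w.
Proof.
split=> [|[u Xu <-]]; last exact: wordW_parabolic.
move/(_ (fun w => exists2 u, all (mem X) u & wordW u = w)); apply; split.
  split; first by exists [::].
  - move=> _ _ [u Xu <-] [v Xv <-]; exists (u ++ v); rewrite ?wordW_cat //.
    by rewrite all_cat Xu Xv.
  - by move=> _ [u Xu <-]; exists (rev u); rewrite ?wordW_rev // all_rev.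
by move=> _ [s Xs <-]; exists [:: s]; rewrite //= andbT.
Qed.

Definition Xmin (w : W) : Prop := forall d, WX d -> len w <= len (d * w).

Lemma Xmin_decomp w : exists2 d, WX d & Xmin (d^-1 * w).
Proof.
have [WX1 WXM WXV] := parabolic_subgroup.
have ex : exists n, `[< exists2 d, WX d & len (d * w) = n >].
  by exists (len w); apply/asboolP; exists 1; rewrite ?mul1g.
case: (ex_minnP ex) => n /asboolP[d WXd dn] nmin.
exists d^-1; first exact: WXV.
move=> e WXe; rewrite invgK dn mulgA; apply: nmin; apply/asboolP.
by exists (e * d) => //; apply: WXM.
Qed.

(** If a letter of X shortens u' w, exchange deletes a letter of u' or of a reduced word of w;
    the latter contradicts the minimality of w in its coset. *)
Lemma Xword_reduce w u : Xmin w -> all (mem X) u ->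
  exists u', [/\ all (mem X) u', wordW u' = wordW u & len (wordW u' * w) = (size u' + len w)%N].
Proof.
have [WX1 WXM WXV] := parabolic_subgroup.
move=> wmin; elim: u => [|s u IH] /=; first by exists [::]; rewrite wordW0 mul1g.
case/andP=> Xs /IH [v [Xv vu lv]].
have [lsv|lsv] := len_rl s (wordW v * w).
  exists (s :: v); rewrite /= Xs Xv !wordW_cons vu; split=> //.
  by rewrite -mulgA -vu lsv lv.
have [y sy yw] := reduced_word w.
have := @exchange s (v ++ y); rewrite wordW_cat yw lsv => /(_ (leqnn _)).
case=> v1 [t [v2 [E1 E2]]].
have Xs' := gen_parabolic Xs.
have [sz|sz] := ltnP (size v1) (size v); last first.
  have Ev := congr1 (take (size v)) E1; rewrite take_size_cat // takel_cat // in Ev.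
  have Ey : wordW (drop (size v) v1 ++ v2) = (wordW v)^-1 * (r s * (wordW v * w)).
    apply: (mulgI (wordW v)); rewrite mulVKg E2 -wordW_cat {1}Ev catA cat_take_drop //.
  have WXe : WX ((wordW v)^-1 * (r s * wordW v)).
    by apply: (WXM); [apply: WXV | apply: (WXM) => //]; apply: wordW_parabolic.
  have := wmin ((wordW v)^-1 * (r s * wordW v)).
  rewrite -!mulgA -Ey => h; have {h} /leq_trans/(_ (len_wordW _)) := h WXe.
  by rewrite -sy; have := congr1 size E1; rewrite !size_cat /= size_drop; lia.
have Ev : v = v1 ++ t :: take (size v - (size v1).+1) v2.
  have := congr1 (take (size v)) E1; rewrite take_size_cat // => {1}->.
  by rewrite take_cat ltnNge (ltnW sz) /= -subnSK.
exists (v1 ++ take (size v - (size v1).+1) v2).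
have E3 : r s * wordW v = wordW (v1 ++ take (size v - (size v1).+1) v2).
  apply: (mulIg w); rewrite -mulgA E2 -yw -wordW_cat -catA; congr (wordW (_ ++ _)).
  rewrite -{1}(cat_take_drop (size v - (size v1).+1) v2); congr (_ ++ _).
  have := congr1 (drop (size v)) E1; rewrite drop_size_cat // drop_cat ltnNge (ltnW sz) /=.
  by rewrite -subnSK.
split.
- by move: Xv; rewrite {1}Ev !all_cat /= => /and3P[-> _ ->].
- by rewrite wordW_cons -vu E3.
rewrite -E3 -mulgA; have := congr1 size Ev; rewrite !size_cat /=.
by move: lsv; rewrite lv; move: (size (take _ _)) (len (r s * _)) => n1 n2; lia.
Qed.

Lemma Xmin1 : Xmin 1. Proof. by move=> d _; rewrite len1. Qed.

Lemma reduced_Xword d : WX d -> exists u, [/\ all (mem X) u, wordW u = d & size u = len d].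
Proof.
case/parabolicP=> u Xu <-; have [u' [Xu' uu' l]] := Xword_reduce Xmin1 Xu.
by exists u'; split=> //; move: l; rewrite mulg1 uu' len1 addn0.
Qed.

Lemma len_Xmin d w : WX d -> Xmin w -> len (d * w) = (len d + len w)%N.
Proof.
case/parabolicP=> u Xu <- wmin; have [u' [_ <- l]] := Xword_reduce wmin Xu.
apply/eqP; rewrite eqn_leq lenM l leq_add2r; exact: len_wordW.
Qed.

End Parabolic.
End Words.

(* Equal lengths may contain group operations inferred along different structure paths;
   abstracting each length identifies such occurrences. *)
Ltac len_lia :=
  repeat match goal with H : context [len _] |- _ => revert H end;
  repeat match goal with |- context [len ?x] => move: (len x) => ? end;
  repeat match goal with |- context [size ?x] => move: (size x) => ? end;
  lia.

(** * Rank two *)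

Section Dihedral.
Variables (S : finType) (M : coxeter_matrix S).
Local Notation W := (coxeter_group M).
Local Notation r := (coxeter_gen M).
Local Notation wordW := (wordW M).

(** Moving the letters of one side across, the equality becomes the triviality of a power of
    s t. *)
Lemma alt_eq1 s t i j k : s != t -> (i + j = k.*2)%N ->
  wordW (alt s t i) = wordW (alt t s j) -> if M s t is Some m then m %| k else k == 0.
Proof.
move=> st; elim: j i s t st => [|j IH] i s t st.
  rewrite addn0 => -> /class_of_wordP; rewrite posword_alt; exact: alt_word_order.
rewrite addnS -addSn => E /alt_shiftV /(IH _ t s); rewrite eq_sym st => /(_ isT E).
by rewrite cox_sym.
Qed.

Lemma gen_inj : injective r.
Proof.
move=> s t rst; apply/eqP; apply: contraT => st.
have := @alt_eq1 s t 1 1 1 st (erefl _); rewrite /alt !wordW1 => /(_ rst).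
by case E: (M s t) => [m|] //; have := cox_offdiag st E; rewrite dvdn1; lia.
Qed.

Lemma reduced_alt s t u : size u = len (wordW u) -> all (mem [set s; t]) u ->
  u = alt s t (size u) \/ u = alt t s (size u).
Proof.
elim: u => [|x u IH] red; first by left.
rewrite /= => /andP[]; rewrite !inE => xst Xu.
have redu : size u = len (wordW u).
  by have := lenM (r x) (wordW u); have := len_wordW M u; rewrite -wordW_cons -red len_r /=; lia.
have h y n : y != x -> u <> alt x y n.+1.
  move=> yx E; move: red; rewrite E /= !wordW_cons genKl.
  by have := len_wordW M (alt y x n); lia.
have st0 : s = t -> u = [::].
  move=> st; case: (u) xst Xu red => [|y v] //=; rewrite -st !orbb !inE => /eqP ->.
  rewrite !orbb => /andP[/eqP -> _]; rewrite !wordW_cons genKl.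
  by have := len_wordW M v; lia.
have [st|st] := eqVneq s t.
  by rewrite (st0 st) /=; case/orP: xst => /eqP ->; [left|right].
have ts : t != s by rewrite eq_sym.
case/orP: xst => /eqP Ex; rewrite Ex in h *.
  left; congr (_ :: _); case: (IH redu Xu) => //; case: (size u) => // n E.
  by case: (h t n).
right; congr (_ :: _); case: (IH redu Xu) => //; case: (size u) => // n E.
by case: (h s n).
Qed.

Lemma reduced_dihedral s t d : coxeter_parabolic M [set s; t] d ->
  d = wordW (alt s t (len d)) \/ d = wordW (alt t s (len d)).
Proof.
case/reduced_Xword => u [Xu <- su].
by have [||E|E] := @reduced_alt s t u => //; rewrite -su -?E; [left|right].
Qed.

Lemma wordW_alt_dihedral s t k : coxeter_parabolic M [set s; t] (wordW (alt s t k)).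
Proof.
by apply: wordW_parabolic; apply: all_alt; rewrite !inE eqxx ?orbT.
Qed.

(** A shorter alternating expression would give s t a smaller order than its label. *)
Lemma alt_reduced s t k : s != t -> (forall m, M s t = Some m -> k <= m) ->
  len (wordW (alt s t k)) = k.
Proof.
elim: k s t => [|k IH] s t st km; first exact: len1.
have ts : t != s by rewrite eq_sym.
have IHts : len (wordW (alt t s k)) = k.
  by apply: IH => // m; rewrite cox_sym => /km; apply: ltnW.
have [l|l] := len_rl s (wordW (alt t s k)); first by rewrite /= wordW_cons l IHts.
exfalso; rewrite -wordW_cons -/(alt s t k.+1) IHts in l.
have := reduced_dihedral (@wordW_alt_dihedral s t k.+1).
move: l; move: (len (wordW (alt s t k.+1))) => n Ek; rewrite {k}Ek in km IH IHts *.
have bad : wordW (alt s t n.+2) <> wordW (alt t s n).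
  move=> E; have := @alt_eq1 s t n.+2 n n.+1 st _ E; rewrite -addnn addSnnS => /(_ erefl).
  by case Mst: (M s t) => [m|] // /dvdn_leq; have := km _ Mst; lia.
case=> // E; case: n => [|n] in km IH IHts E bad *; first exact: bad.
move: E; rewrite /= !(wordW_cons _ s) => /mulgI E.
by move: IHts; rewrite -[alt t s n.+2]/([:: t, s & alt t s n]) E;
   have := len_wordW M (alt t s n); rewrite size_alt; lia.
Qed.

(** In the coset of w modulo the dihedral subgroup of s and t, the dihedral part has both
    descents, so its reduced words start with s and with t: it is the longest dihedral
    element. *)
Lemma descents2 s t w : s != t -> len (r s * w) < len w -> len (r t * w) < len w ->
  exists m, M s t = Some m /\
  exists2 w', w = wordW (alt s t m) * w' & len w = (m + len w')%N.
Proof.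
move=> st ls lt; pose X := [set s; t].
have [d Xd] := Xmin_decomp X w; set w' := d^-1 * w => wmin.
have Ew : w = d * w' by rewrite mulVKg.
have Xgen x : x \in X -> coxeter_parabolic M X (r x) by exact: gen_parabolic.
have [WX1 WXM WXV] := parabolic_subgroup M X.
have desc x : x \in X -> len (r x * w) < len w -> len (r x * d) < len d.
  move=> Xx; rewrite Ew mulgA !(len_Xmin _ wmin) ?ltn_add2r //.
  by apply: WXM => //; apply: Xgen.
have Xs : s \in X by rewrite !inE eqxx.
have Xt : t \in X by rewrite !inE eqxx orbT.
have first x : x \in X -> len (r x * w) < len w ->
    exists v, [/\ all (mem X) (x :: v), wordW (x :: v) = d & size (x :: v) = len d].
  move=> Xx lx; have ld := desc x Xx lx.
  have [|v [Xv vE sv]] := @reduced_Xword _ M X (r x * d).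
    by apply: WXM => //; apply: Xgen.
  exists v; rewrite wordW_cons vE genKl /= Xx sv; split=> //.
  by have := len_rl x d; lia.
have Es : d = wordW (alt s t (len d)).
  have [v [Xv vE sv]] := first s Xs ls.
  have [||E|[E _]] := @reduced_alt s t (s :: v); rewrite ?vE //.
    by rewrite -sv -E vE.
  by rewrite E eqxx in st.
have Et : d = wordW (alt t s (len d)).
  have [v [Xv vE sv]] := first t Xt lt.
  have [||[E _]|E] := @reduced_alt s t (t :: v); rewrite ?vE //.
    by rewrite E eqxx in st.
  by rewrite -sv -E vE.
have d0 : 0 < len d by have := desc s Xs ls; lia.
have := @alt_eq1 s t (len d) (len d) (len d) st; rewrite addnn => /(_ erefl).
rewrite -Es -Et => /(_ erefl).
case Mst: (M s t) => [m|]; last by lia.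
move/(dvdn_leq d0) => md; have m2 := cox_offdiag st Mst.
have ld : len d = m.
  apply/eqP; rewrite eqn_leq md andbT leqNgt; apply/negP => lt_m.
  have cat_alt (x y : S) i j : exists v, alt x y (i + j) = alt x y i ++ v /\ size v = j.
    elim: i x y => [|i IH] x y; first by exists (alt x y j); rewrite size_alt.
    by have [v [E sv]] := IH y x; exists v; rewrite /= E.
  have [v [E sv]] := cat_alt s t m.+1 (len d - m.+1).
  rewrite subnKC // in E; move: Es; rewrite E wordW_cat /= wordW_cons -wordW_braid //.
  case: m m2 Mst {md E} lt_m sv => // m _ _ lt_m sv; rewrite /= wordW_cons genKl => Ed.
  have := lenM (wordW (alt t s m)) (wordW v); rewrite -Ed.
  by have := len_wordW M v; have := len_wordW M (alt t s m); rewrite size_alt; lia.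
exists m; split=> //; exists w'; first by rewrite {1}Ew Es ld.
by rewrite {1}Ew (len_Xmin Xd wmin) ld.
Qed.

Lemma no_descent_Xmin (X : {set S}) w : (forall s, s \in X -> len w < len (r s * w)) -> Xmin X w.
Proof.
move=> nd; have [d Xd wmin] := Xmin_decomp X w.
have [u [Xu Ed su]] := reduced_Xword Xd.
have Ew : w = d * (d^-1 * w) by rewrite mulVKg.
case: u Xu Ed su => [_ d1 _|s u /= /andP[Xs Xu] Ed su].
  by move: wmin; rewrite -d1 wordW0 invg1 mul1g.
have := nd s Xs; rewrite {2}Ew -{1}Ed wordW_cons -mulgA genKl.
have /len_Xmin -/(_ _ wmin) -> : coxeter_parabolic M X (wordW u) by apply: wordW_parabolic.
by rewrite {1}Ew (len_Xmin Xd wmin) -su; have := len_wordW M u; lia.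
Qed.

(** An element without descents at s and t is minimal in its dihedral coset, so lengths
    add. *)
Lemma ascents2 s t m u : s != t -> M s t = Some m ->
  len u < len (u * r s) -> len u < len (u * r t) ->
  len (u * wordW (alt s t m)) = (len u + m)%N.
Proof.
move=> st Mst us ut.
have umin : Xmin [set s; t] u^-1.
  apply: no_descent_Xmin => x; rewrite !inE lenV => /orP[]/eqP ->;
    by rewrite -[r _ * _]invgK lenV invgM invgK genV.
rewrite -lenV invgM (len_Xmin _ umin) ?lenV.
  have -> : len (wordW (alt s t m)) = m; last exact: addnC.
  by apply: alt_reduced => // m'; rewrite Mst => -[->].
have [_ _] := parabolic_subgroup M [set s; t]; apply; exact: wordW_alt_dihedral.
Qed.
End Dihedral.

(** * The weak order *)

Section WeakOrder.
Variables (S : finType) (M : coxeter_matrix S).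
Local Notation W := (coxeter_group M).
Local Notation r := (coxeter_gen M).
Local Notation wordW := (wordW M).

Definition weak_le (x w : W) : Prop := len w = (len x + len (x^-1 * w))%N.

Lemma weak_le_refl w : weak_le w w.
Proof. by rewrite /weak_le mulVg len1 addn0. Qed.

Lemma weak_le1 w : weak_le 1 w.
Proof. by rewrite /weak_le len1 invg1 mul1g. Qed.

Lemma weak_le_trans x y w : weak_le x y -> weak_le y w -> weak_le x w.
Proof.
rewrite /weak_le => xy yw.
have := lenM x (x^-1 * w); have := lenM (x^-1 * y) (y^-1 * w).
by rewrite mulVKg -mulgA mulVKg; len_lia.
Qed.

Lemma weak_le_mul x y : weak_le x (x * y) <-> len (x * y) = (len x + len y)%N.
Proof. by rewrite /weak_le mulKg. Qed.

Lemma weak_le_len_eq x w : weak_le x w -> len w <= len x -> x = w.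
Proof.
rewrite /weak_le => xw wx; have /eqP : len (x^-1 * w) = 0 by len_lia.
by rewrite len_eq0 mulg_eq1 => /eqP/invg_inj.
Qed.

Lemma weak_le_antisym x y : weak_le x y -> weak_le y x -> x = y.
Proof. by move=> xy yx; apply: weak_le_len_eq => //; rewrite yx; len_lia. Qed.

Lemma weak_le_mul2l x y w : len (x * w) = (len x + len w)%N -> weak_le y w ->
  weak_le (x * y) (x * w) /\ len (x * y) = (len x + len y)%N.
Proof.
rewrite /weak_le invgM -mulgA mulKg => xw yw.
have := lenM (x * y) (y^-1 * w); have := lenM x y.
by rewrite -mulgA mulVKg; len_lia.
Qed.

Lemma weak_le_mul_cancel x y w : len (x * w) = (len x + len w)%N ->
  len (x * y) = (len x + len y)%N -> weak_le (x * y) (x * w) -> weak_le y w.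
Proof. by rewrite /weak_le invgM -mulgA mulKg; len_lia. Qed.

(** Read off the first letter of a reduced word of the quotient. *)
Lemma weak_le_step X u v : weak_le u v -> u <> v -> coxeter_parabolic M X (u^-1 * v) ->
  exists s, [/\ s \in X, weak_le (u * r s) v & len (u * r s) = (len u).+1].
Proof.
move=> uv nuv /reduced_Xword [[|s y] [Xy Ey sy]].
  by case: nuv; apply: invg_inj; apply/eqP; rewrite -mulg_eq1 -Ey.
exists s; move: Xy => /= /andP[Xs _].
have Ev : (u * r s)^-1 * v = wordW y.
  by rewrite invgM genV -mulgA -Ey wordW_cons genKl.
have ly := len_wordW M y; have lus := lenM u (r s); rewrite len_r in lus.
have := lenM (u * r s) ((u * r s)^-1 * v); rewrite mulVKg Ev.
by rewrite /weak_le Ev; rewrite /weak_le -sy /= in uv; split=> //; len_lia.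
Qed.

End WeakOrder.

(** * The lift of the Coxeter group to the Artin group *)

Section Lift.
Variables (S : finType) (M : coxeter_matrix S).
Local Notation W := (coxeter_group M).
Local Notation r := (coxeter_gen M).
Local Notation A := (artin_group M).
Local Notation a := (artin_gen M).
Local Notation wordW := (wordW M).
Local Notation wordA := (wordA M).

Definition reduced (u : seq S) : Prop := size u = len (wordW u).

Lemma reduced_behead s u : reduced (s :: u) -> reduced u.
Proof.
rewrite /reduced wordW_cons /= => red.
by have := lenM (r s) (wordW u); rewrite len_r; have := len_wordW M u; len_lia.
Qed.

Lemma reduced_descent s u : reduced (s :: u) -> len (r s * wordW (s :: u)) < len (wordW (s :: u)).
Proof. by rewrite /reduced => <-; rewrite wordW_cons genKl; apply: len_wordW. Qed.

(** Induction on length. When the first letters s and t differ, both are descents, so the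
    element has a reduced word starting with the alternating word of length m(s, t), on which the
    braid relation exchanges s and t. *)
Lemma matsumoto u v : reduced u -> reduced v -> wordW u = wordW v -> wordA u = wordA v.
Proof.
have [n] := ubnP (size u); elim: n u v => // n IH u v un ru rv uv.
have suv : size u = size v by rewrite ru rv uv.
case: u v suv un ru rv uv => [|s u] [|t v] //= [suv] un ru rv uv.
have redu := reduced_behead ru; have redv := reduced_behead rv.
have [st|st] := eqVneq s t.
  move: uv; rewrite -st !wordW_cons => /mulgI uv; rewrite !wordA_cons; congr (_ * _).
  exact: IH.
have ds := reduced_descent ru; have dt := reduced_descent rv; rewrite -uv in dt.
have [m [Mst [w' Ew lw]]] := descents2 st ds dt.
have [y ly Ey] := reduced_word w'.
have m2 := cox_offdiag st Mst.
have step x z p : x != z -> M x z = Some m -> reduced (x :: p) -> wordW (x :: p) = wordW (s :: u) ->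
    wordW (s :: u) = wordW (alt x z m) * w' -> size p < n ->
    wordA (x :: p) = wordA (alt x z m) * wordA y.
  move=> xz Mxz rp Ep E sp; have redp := reduced_behead rp.
  case: m m2 {Mst Ew Mxz} lw E => // m _ lw; rewrite /= !wordA_cons -mulgA -wordA_cat -Ep.
  rewrite !wordW_cons -mulgA => /mulgI Ep'; congr (_ * _); apply: IH => //; last first.
    by rewrite wordW_cat Ey.
  rewrite /reduced wordW_cat Ey -Ep' -redp size_cat size_alt ly.
  have sp1 : (size p).+1 = len (wordW (s :: u)) by rewrite -Ep -rp.
  by move: sp1; rewrite lw; len_lia.
rewrite (step s t u) // (step t s v) //.
- by rewrite (wordA_braid st Mst).
- by rewrite eq_sym.
- by rewrite cox_sym.
- by rewrite -(wordW_braid st Mst).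
by rewrite -suv.
Qed.

Definition rword (w : W) : seq S := s2val (cid2 (reduced_word w)).
Lemma wordW_rword w : wordW (rword w) = w. Proof. by rewrite /rword; case: cid2. Qed.
Lemma size_rword w : size (rword w) = len w. Proof. by rewrite /rword; case: cid2. Qed.
Lemma reduced_rword w : reduced (rword w).
Proof. by rewrite /reduced wordW_rword size_rword. Qed.

Definition artin_lift (w : W) : A := wordA (rword w).

Lemma lift_reduced u : reduced u -> artin_lift (wordW u) = wordA u.
Proof. by move=> ru; apply: matsumoto => //; [apply: reduced_rword | rewrite wordW_rword]. Qed.

Lemma liftM v w : len (v * w) = (len v + len w)%N -> artin_lift (v * w) = artin_lift v * artin_lift w.
Proof.
move=> vw; rewrite /artin_lift -wordA_cat; apply: matsumoto; first exact: reduced_rword.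
  by rewrite /reduced size_cat wordW_cat !wordW_rword !size_rword.
by rewrite wordW_cat !wordW_rword.
Qed.

Lemma lift1 : artin_lift 1 = 1.
Proof. by apply: (@lift_reduced [::]); rewrite /reduced wordW0 len1. Qed.

Lemma lift_gen s : artin_lift (r s) = a s.
Proof. by apply: (@lift_reduced [:: s]); rewrite /reduced wordW1 len_r. Qed.

Lemma lift_alt s t m : s != t -> M s t = Some m -> artin_lift (wordW (alt s t m)) = wordA (alt s t m).
Proof.
move=> st Mst; apply: lift_reduced; rewrite /reduced size_alt.
by apply: esym; apply: alt_reduced => // m'; rewrite Mst => -[->].
Qed.

(** If w s is longer than w, both sides lift the element w s. Otherwise w = v s = t v for the
    shorter element v = w s, and both sides are the lift of t, then of v, then of s. This holds
    for every w, so each permutation of X induced by an element of W is induced by its lift. *)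
Lemma lift_conj w s t : w * r s = r t * w -> artin_lift w * a s = a t * artin_lift w.
Proof.
move=> E; rewrite -!lift_gen; have l2 : len (r t * w) = len (w * r s) by rewrite E.
have [l|l] := len_rr s w.
  rewrite -liftM ?l ?len_r ?addn1 // E liftM //.
  by rewrite l2 l len_r.
have E1 : w = (w * r s) * r s by rewrite genKr.
have E2 : w = r t * (w * r s) by rewrite E genKl.
have L1 : artin_lift w = artin_lift (w * r s) * artin_lift (r s).
  by rewrite -liftM ?genKr // len_r addn1.
have L2 : artin_lift w = artin_lift (r t) * artin_lift (w * r s).
  by rewrite -liftM -?E2 // len_r add1n.
by rewrite {1}L2 L1 mulgA.
Qed.

End Lift.

(** * The projection and the parabolic subgroups of the Artin group *)

Section ArtinSide.
Variables (S : finType) (M : coxeter_matrix S).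
Local Notation W := (coxeter_group M).
Local Notation r := (coxeter_gen M).
Local Notation A := (artin_group M).
Local Notation a := (artin_gen M).
Local Notation wordW := (wordW M).
Local Notation wordA := (wordA M).
Local Notation artin_lift := (@artin_lift S M).
Local Notation AX := (artin_parabolic M).
Local Notation WX := (coxeter_parabolic M).

Definition artin_proj (x : A) : W :=
  class_of_word (coxeter_rel M) (repr (x : {eq_quot wcongrb (artin_rel M)})).

Lemma wcongr_artin_coxeter u v : wcongr (artin_rel M) u v -> wcongr (coxeter_rel M) u v.
Proof.
elim=> {u v}; [exact: wcongr_refl|by move=> *; apply: wcongr_sym| | | |].
- by move=> u v w _ uv _; apply: wcongr_trans.
- by move=> u u' v v' _ uu' _; apply: wcongr_cat.
- exact: wcongr_cancel.
by move=> u v uv; apply/wcongr_rel/CoxeterBraid.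
Qed.

Lemma artin_projE u : artin_proj (class_of_word (artin_rel M) u) = class_of_word (coxeter_rel M) u.
Proof. by apply/class_of_wordP/wcongr_artin_coxeter/wcongr_repr. Qed.

Lemma artin_projM x y : artin_proj (x * y) = artin_proj x * artin_proj y.
Proof.
by rewrite -[x]class_of_repr -[y]class_of_repr -class_of_cat !artin_projE class_of_cat.
Qed.

Lemma artin_proj1 : artin_proj 1 = 1. Proof. exact: (artin_projE [::]). Qed.

Lemma artin_projV x : artin_proj x^-1 = (artin_proj x)^-1.
Proof. by apply/esym/mulg1_eq; rewrite -artin_projM mulgV artin_proj1. Qed.

Lemma artin_proj_gen s : artin_proj (a s) = r s. Proof. exact: artin_projE. Qed.
Lemma artin_proj_wordA u : artin_proj (wordA u) = wordW u. Proof. exact: artin_projE. Qed.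
Lemma artin_proj_lift w : artin_proj (artin_lift w) = w. Proof. by rewrite artin_proj_wordA wordW_rword. Qed.

Lemma artin_gen_inj : injective a.
Proof. by move=> s t E; apply: (@gen_inj _ M); rewrite -!artin_proj_gen E. Qed.

(** The signed number of letters is an invariant of the group element. *)
Lemma wordA_size u v : wordA u = wordA v -> size u = size v.
Proof.
move=> /class_of_wordP uv.
pose act (n : int) (l : S * bool) : int := (n + (if l.2 then 1 else -1))%R.
have actE w n : foldl act n (posword w) = (n + (size w)%:Z)%R.
  by elim: w n => [|s w IH] n /=; rewrite ?IH /act /=; lia.
have : foldl act 0%R (posword u) = foldl act 0%R (posword v).
  move: uv 0%R; apply: wcongr_foldl => [n s [] /=|_ _ [s t m _ _] n].
  - by rewrite /act /=; lia.
  - by rewrite /act /=; lia.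
  by rewrite -!posword_alt !actE !size_alt.
by rewrite !actE; lia.
Qed.

Lemma wordA_parabolic (X : {set S}) u : all (mem X) u -> AX X (wordA u).
Proof.
have [H1 HM _] := generated_subgroup [set a x | x in [set` X]]%classic.
elim: u => [_|s u IH] //= /andP[Xs /IH Hu]; rewrite wordA_cons; apply: HM => //.
by apply: mem_generated; exists s.
Qed.

Lemma lift_parabolic (X : {set S}) w : WX X w -> AX X (artin_lift w).
Proof.
case/reduced_Xword => u [Xu <- su].
by rewrite lift_reduced //; apply: wordA_parabolic.
Qed.

Lemma artin_proj_parabolic (X : {set S}) x : AX X x -> WX X (artin_proj x).
Proof.
have [H1 HM HV] := parabolic_subgroup M X.
apply: (@generated_ind _ _ (fun x => WX X (artin_proj x))).
- move=> _ [s Xs <-]; rewrite artin_proj_gen; exact: gen_parabolic.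
- by rewrite artin_proj1.
- by move=> x' y Hx Hy; rewrite artin_projM; apply: HM.
- by move=> x' Hx; rewrite artin_projV; apply: HV.
Qed.

Lemma artin_centralizerE (X : {set S}) : artin_centralizer M X = centralizer (AX X).
Proof.
apply/seteqP; split=> g /= gX; last first.
  by move=> s Xs; apply: gX; apply: mem_generated; exists s.
apply: (@generated_ind _ _ (fun x => g * x = x * g)).
- by move=> _ [s Xs <-]; apply: gX.
- by rewrite mul1g mulg1.
- by move=> x y gx gy; rewrite mulgA gx -mulgA gy mulgA.
- by move=> x gx; apply: (mulgI x); rewrite mulgA -gx mulVKg mulgK.
Qed.
End ArtinSide.

(** * Greatest elements in the weak order *)

Section Spherical.
Variables (S : finType) (M : coxeter_matrix S).
Local Notation W := (coxeter_group M).
Local Notation r := (coxeter_gen M).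
Local Notation A := (artin_group M).
Local Notation a := (artin_gen M).
Local Notation wordW := (wordW M).
Local Notation wordA := (wordA M).
Local Notation artin_lift := (@artin_lift S M).
Local Notation artin_proj := (@artin_proj S M).
Local Notation AX := (artin_parabolic M).
Local Notation WX := (coxeter_parabolic M).

Hypothesis fin : spherical M.

Lemma len_bounded : exists B, forall w : W, len w <= B.
Proof.
have /finite_seqP [e eE] := fin; exists (\max_(w <- e) len w) => w.
have : [set` e]%classic w by rewrite -eE.
by move=> we; apply: bigop.leq_bigmax_seq.
Qed.

(** An infinite label would make all alternating words reduced, of unbounded length. *)
Lemma label_finite s t : s != t -> exists m, M s t = Some m.
Proof.
move=> st; case E: (M s t) => [m|]; first by exists m.
have [B HB] := len_bounded; have := HB (wordW (alt s t B.+1)).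
by rewrite alt_reduced ?ltnn // => m; rewrite E.
Qed.

(** Newman's lemma. Steps u -> u s going up inside E terminate because lengths are bounded, and
    are locally confluent because u s and u t have the upper bound u (s t s ...), which lies in E.
    Every element of E is reached from 1, so the unique normal form is the maximum of E. *)
Lemma weak_le_max (E : W -> Prop) (X : {set S}) :
    E 1 ->
    (forall u v, E u -> E v -> weak_le u v -> u <> v ->
       exists s, [/\ s \in X, E (u * r s), weak_le (u * r s) v & len (u * r s) = (len u).+1]) ->
    (forall u s t m, E u -> s \in X -> t \in X -> s != t -> M s t = Some m ->
       E (u * r s) -> E (u * r t) -> len (u * r s) = (len u).+1 ->
       len (u * r t) = (len u).+1 -> E (u * wordW (alt s t m))) ->
  exists2 w, E w & forall u, E u -> weak_le u w.
Proof.
move=> E1 step join; have [B HB] := len_bounded.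
suff H n u : E u -> B - len u <= n -> exists w, [/\ E w, weak_le u w &
    forall v, E v -> weak_le u v -> weak_le v w].
  have [w [Ew _ wmax]] := H B 1 E1 (leq_subr _ _).
  by exists w => // u Eu; apply: wmax => //; apply: weak_le1.
elim: n u => [|n IH] u Eu ln.
  exists u; split=> //; first exact: weak_le_refl.
  move=> v _ uv; rewrite (weak_le_len_eq uv); first exact: weak_le_refl.
  by have := HB v; len_lia.
have [[s [Xs Eus lus]]|nos] :=
  pselect (exists s, [/\ s \in X, E (u * r s) & len (u * r s) = (len u).+1]); last first.
  exists u; split=> //; first exact: weak_le_refl.
  move=> v Ev uv; have [->|nuv] := pselect (u = v); first exact: weak_le_refl.
  by have [s [Xs Es _ ls]] := step u v Eu Ev uv nuv; case: nos; exists s.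
have weak_le_us x : len (u * r x) = (len u).+1 -> weak_le u (u * r x).
  by move=> l; apply/weak_le_mul; rewrite l len_r addn1.
have [|w [Ew uw wmax]] := IH (u * r s) Eus; first by len_lia.
exists w; split=> //; first by apply: weak_le_trans uw; apply: weak_le_us.
move=> v Ev uv; have [<-|nuv] := pselect (u = v).
  by apply: weak_le_trans uw; apply: weak_le_us.
have [t [Xt Eut utv lut]] := step u v Eu Ev uv nuv.
have [ts|ts] := eqVneq t s; first by apply: wmax; rewrite // -ts.
have [|w' [Ew' uw' wmax']] := IH (u * r t) Eut; first by len_lia.
have [m Mts] := label_finite ts.
have Ej := join u t s m Eu Xt Xs ts Mts Eut Eus lut lus.
have m2 := cox_offdiag ts Mts.
have lj : len (u * wordW (alt t s m)) = (len u + m)%N by apply: ascents2; rewrite ?lut ?lus.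
have low x y : x != y -> M x y = Some m -> len (u * r x) = (len u).+1 ->
    len (u * wordW (alt x y m)) = (len u + m)%N -> weak_le (u * r x) (u * wordW (alt x y m)).
  move=> xy Mxy lx lxy; case: m m2 {Mts Ej lj} Mxy lxy => // m _ Mxy lxy.
  rewrite /weak_le lxy lx invgM -mulgA mulKg /= wordW_cons genV genKl alt_reduced ?addSnnS //.
    by rewrite eq_sym.
  by move=> m'; rewrite cox_sym Mxy => -[<-].
have jw' : weak_le (u * wordW (alt t s m)) w' by apply: wmax' => //; apply: low.
have usw' : weak_le (u * r s) w'.
  apply: weak_le_trans jw'; rewrite (wordW_braid ts Mts); apply: low.
  - by rewrite eq_sym.
  - by rewrite cox_sym.
  - by [].
  - by rewrite -(wordW_braid ts Mts).
by apply: (weak_le_trans (y := w')); [apply: wmax' | apply: wmax].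
Qed.

Lemma longest_exists (X : {set S}) :
  exists2 w, coxeter_parabolic M X w & forall u, coxeter_parabolic M X u -> weak_le u w.
Proof.
have [WX1 WXM WXV] := parabolic_subgroup M X.
have WXr s : s \in X -> coxeter_parabolic M X (r s) by exact: gen_parabolic.
apply: (@weak_le_max _ X) => //.
  move=> u v Xu Xv uv nuv; have [|s [Xs h1 h2]] := weak_le_step (X := X) uv nuv.
    by apply: WXM => //; apply: WXV.
  by exists s; split=> //; apply: WXM => //; apply: WXr.
move=> u s t m Xu Xs Xt _ _ _ _ _ _; by apply: WXM => //; apply: wordW_parabolic; apply: all_alt.
Qed.

Definition longest X : W := s2val (cid2 (longest_exists X)).

Lemma longest_mem X : coxeter_parabolic M X (longest X).
Proof. exact: s2valP. Qed.

Lemma weak_le_longest X u : coxeter_parabolic M X u -> weak_le u (longest X).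
Proof. by move=> Xu; rewrite /longest; case: cid2 => w /= _; apply. Qed.

Lemma longestV X : (longest X)^-1 = longest X.
Proof.
have [WX1 WXM WXV] := parabolic_subgroup M X.
apply: weak_le_len_eq; last by rewrite lenV.
by apply: weak_le_longest; apply: WXV; apply: longest_mem.
Qed.

Lemma longest2 X : longest X * longest X = 1.
Proof. by rewrite -{1}longestV mulVg. Qed.

(** Let w0 be longest in W_X. Every w of W_X satisfies len (w0 w^-1) = len w0 - len w; for
    w = w0 s this says that w0 s w0 has length one. *)
Lemma longest_conj (X : {set S}) s : s \in X ->
  exists t, [/\ t \in X, r t * longest X = longest X * r s &
    len (longest X) = (len (longest X * r s)).+1].
Proof.
have [WX1 WXM WXV] := parabolic_subgroup M X; have Xw0 := @longest_mem X.
move=> Xs; have WXs : coxeter_parabolic M X (r s) by exact: gen_parabolic.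
have l1 := weak_le_longest WXs; rewrite /weak_le genV len_r in l1.
have l2 : len (longest X * r s) = len (r s * longest X).
  by rewrite -lenV invgM genV longestV.
have l3 := weak_le_longest (WXV _ (WXM _ _ Xw0 WXs)).
rewrite /weak_le lenV invgK in l3.
have [|u [Xu uE su]] := @reduced_Xword _ M X (longest X * r s * longest X).
  by apply: (WXM) => //; apply: WXM.
case: u Xu uE su => [|t [|x u]] /= Xu uE su; try len_lia.
exists t; split; last by len_lia.
  by move: Xu; rewrite andbT.
by rewrite -wordW1 uE -!mulgA longest2 mulg1.
Qed.

(** * Greedy prefixes of products of two elements *)

(** The prefixes u of w such that v u is reduced have a greatest element: if u s and u t are
    such prefixes, so is u (s t s ...), because w factors through it by [descents2] and its product
    with v is reduced by [ascents2]. *)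
Lemma absorb_exists (v w : W) :
  exists2 u, weak_le u w /\ len (v * u) = (len v + len u)%N &
    forall u', weak_le u' w -> len (v * u') = (len v + len u')%N -> weak_le u' u.
Proof.
pose E u := weak_le u w /\ len (v * u) = (len v + len u)%N.
suff [u Eu umax] : exists2 u, E u & forall u', E u' -> weak_le u' u.
  by exists u => // u' h1 h2; apply: umax.
(* The whole group is the parabolic subgroup of S, so the steps carry no condition. *)
have setTP x : coxeter_parabolic M [set: S] x.
  have [y <-] := wordW_surj x; apply: wordW_parabolic; apply/allP => z _ /=; exact: finset.in_setT.
apply: (@weak_le_max _ [set: S]).
- by split; [exact: weak_le1 | rewrite mulg1 len1 addn0].
- move=> x y [xw vx] [yw vy] xy nxy.
  have [s [Xs h1 h2]] := weak_le_step xy nxy (setTP _).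
  exists s; split=> //; split; first exact: weak_le_trans yw.
  by have [] := weak_le_mul2l vy h1.
move=> x s t m [xw vx] _ _ st Mst [sw vs] [tw vt] ls lt.
have lx : len (x * wordW (alt s t m)) = (len x + m)%N by apply: ascents2; rewrite // ?ls ?lt.
split.
  have desc y : len (x * r y) = (len x).+1 -> weak_le (x * r y) w ->
      len (r y * (x^-1 * w)) < len (x^-1 * w).
    by rewrite /weak_le invgM genV -mulgA => l; rewrite /weak_le in xw; len_lia.
  have [m' [Mst' [w' E' lw']]] := descents2 st (desc s ls sw) (desc t lt tw).
  move: Mst' E' lw'; rewrite Mst => -[<-] E' lw'.
  by move: lw' xw; rewrite /weak_le lx invgM -mulgA E' mulKg; len_lia.
have lv y : len (x * r y) = (len x).+1 -> len (v * (x * r y)) = (len v + len (x * r y))%N ->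
    len (v * x) < len (v * x * r y).
  by move=> ly vy; rewrite -mulgA vy vx ly; len_lia.
by rewrite mulgA (ascents2 st Mst (lv s ls vs) (lv t lt vt)) vx lx; len_lia.
Qed.

(** The part of w that can be moved into v: v * w = head2 v w * tail2 v w is the greedy
    factorization of the product of v and w. *)
Definition absorb (v w : W) : W := s2val (cid2 (absorb_exists v w)).
Definition head2 (v w : W) : W := v * absorb v w.
Definition tail2 (v w : W) : W := (absorb v w)^-1 * w.

Lemma absorbP v w : [/\ weak_le (absorb v w) w, len (v * absorb v w) = (len v + len (absorb v w))%N &
  forall u, weak_le u w -> len (v * u) = (len v + len u)%N -> weak_le u (absorb v w)].
Proof. by rewrite /absorb; case: cid2 => u /= [h1 h2] h3; split. Qed.

Lemma absorb_uniq v w u : weak_le u w -> len (v * u) = (len v + len u)%N ->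
  (forall u', weak_le u' w -> len (v * u') = (len v + len u')%N -> weak_le u' u) -> absorb v w = u.
Proof.
move=> h1 h2 h3; have [k1 k2 k3] := absorbP v w.
by apply: weak_le_antisym; [apply: h3 | apply: k3].
Qed.

Lemma len_tail2 v w : len w = (len (absorb v w) + len (tail2 v w))%N.
Proof. by have [] := absorbP v w. Qed.

Lemma weak_le_head2 v w : weak_le v (head2 v w).
Proof. by have [_ h _] := absorbP v w; apply/weak_le_mul. Qed.

(** The part of w absorbed by v v' is already absorbed by v'; v then absorbs v' together with
    exactly this part. *)
Lemma absorb_assoc v v' w : len (v * v') = (len v + len v')%N ->
  absorb v (head2 v' w) = v' * absorb (v * v') w /\ weak_le (absorb (v * v') w) (absorb v' w).
Proof.
move=> vv'; have [h1 h2 h3] := absorbP v' w.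
have [k1 k2 k3] := absorbP v (head2 v' w).
set y := v'^-1 * absorb v (head2 v' w); have Ey : absorb v (head2 v' w) = v' * y by rewrite mulVKg.
have v'y : weak_le v' (v' * y) by rewrite -Ey; apply: k3; [exact: weak_le_head2 | ].
have ly : len (v' * y) = (len v' + len y)%N by apply/weak_le_mul.
have yu' : weak_le y (absorb v' w) by apply: (weak_le_mul_cancel h2 ly); rewrite -Ey.
suff E : absorb (v * v') w = y by rewrite E.
apply: absorb_uniq; first exact: weak_le_trans yu' h1.
  by rewrite -mulgA -Ey k2 Ey ly vv'; len_lia.
move=> u uw; rewrite -mulgA vv' => lu.
have lu2 : len (v' * u) = (len v' + len u)%N.
  by have := lenM v (v' * u); have := lenM v' u; len_lia.
have uu' : weak_le u (absorb v' w) by apply: h3.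
have : weak_le (v' * u) (v' * y).
  rewrite -Ey; apply: k3; first by have [] := weak_le_mul2l h2 uu'.
  by rewrite lu lu2; len_lia.
exact: weak_le_mul_cancel.
Qed.

Lemma head2_assoc v v' w : len (v * v') = (len v + len v')%N ->
  head2 (v * v') w = head2 v (head2 v' w).
Proof. by move=> vv'; rewrite {2}/head2; have [-> _] := absorb_assoc w vv'; rewrite /head2 mulgA. Qed.

Lemma tail2_assoc v v' w : len (v * v') = (len v + len v')%N ->
  tail2 (v * v') w = tail2 v (head2 v' w) * tail2 v' w /\
  len (tail2 (v * v') w) = (len (tail2 v (head2 v' w)) + len (tail2 v' w))%N.
Proof.
move=> vv'; have [E yu] := absorb_assoc w vv'.
have Eo : tail2 v (head2 v' w) = (absorb (v * v') w)^-1 * absorb v' w.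
  by rewrite /tail2 E invgM -mulgA /head2 mulKg.
split; first by rewrite Eo /tail2 -mulgA mulVKg.
have := len_tail2 v' w; have := len_tail2 (v * v') w; rewrite Eo.
by rewrite yu; len_lia.
Qed.

Lemma absorb1 v : absorb v 1 = 1.
Proof.
have [h _ _] := absorbP v 1; apply/eqP; rewrite -len_eq0.
by move: h; rewrite /weak_le len1; len_lia.
Qed.

Lemma head21 v : head2 v 1 = v. Proof. by rewrite /head2 absorb1 mulg1. Qed.
Lemma absorb1l w : absorb 1 w = w.
Proof. by apply: absorb_uniq => //; [exact: weak_le_refl | rewrite mul1g len1]. Qed.

Lemma head21l w : head2 1 w = w. Proof. by rewrite /head2 absorb1l mul1g. Qed.
Lemma tail21l w : tail2 1 w = 1. Proof. by rewrite /tail2 absorb1l mulVg. Qed.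

Notation w0 := (longest [set: S]).

Lemma weak_le_w0 w : weak_le w w0.
Proof.
apply: weak_le_longest; have [y <-] := wordW_surj w; apply: wordW_parabolic.
by apply/allP => z _ /=; exact: finset.in_setT.
Qed.

Lemma absorb_w0 w : absorb w0 w = 1.
Proof.
have [_ h _] := absorbP w0 w; apply/eqP; rewrite -len_eq0.
by have := weak_le_w0 (w0 * absorb w0 w); rewrite /weak_le h; len_lia.
Qed.

Lemma tail2_w0 w : tail2 w0 w = w. Proof. by rewrite /tail2 absorb_w0 invg1 mul1g. Qed.

(** * The greedy action on streams *)

Fixpoint star_at (n : nat) (v : W) (f : nat -> W) : W :=
  if n is n'.+1 then star_at n' (tail2 v (f 0)) (fun k => f k.+1) else head2 v (f 0).
(** Left multiplication of a sequence of simple factors by v: the first factor takes what it can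
    and hands the rest on to the next one. Streams, ending in ones, avoid tracking the number of
    factors. *)
Definition star (v : W) (f : nat -> W) : nat -> W := fun n => star_at n v f.

Lemma star_mul v v' f : len (v * v') = (len v + len v')%N ->
  star (v * v') f = star v (star v' f).
Proof.
move=> vv'; apply/funext => n; rewrite /star.
elim: n v v' f vv' => [|n IH] v v' f vv' /=; first exact: head2_assoc.
by have [-> l] := tail2_assoc (f 0) vv'; rewrite IH // -l; have [->] := tail2_assoc (f 0) vv'.
Qed.

(** The greedy normal form condition on consecutive factors. *)
Definition normal (f : nat -> W) : Prop := forall n, head2 (f n) (f n.+1) = f n.

Lemma head2_normal v w w' : head2 w w' = w -> head2 (head2 v w) (head2 (tail2 v w) w') = head2 v w.
Proof.
move=> ww'; have [h1 h2 _] := absorbP v w.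
have Ew : absorb v w * tail2 v w = w by rewrite mulVKg.
(* The first factor of the product of w and w' is w, whether or not w is cut in two. *)
have E1 : head2 (absorb v w) (head2 (tail2 v w) w') = w.
  by rewrite -head2_assoc Ew ?ww' //; apply: len_tail2.
by rewrite -[X in head2 X _]/(v * absorb v w) head2_assoc // E1.
Qed.

Lemma star_normal v f : normal f -> normal (star v f).
Proof.
move=> nf n; rewrite /star; elim: n v f nf => [|n IH] v f nf /=; first exact: head2_normal.
by apply: IH => k; apply: nf.
Qed.

(** The longest element absorbs nothing, so on a normal stream it acts as the shift. This makes
    its action injective. *)
Lemma star_w0 f n : normal f -> star w0 f n.+1 = f n.
Proof.
move=> nf; rewrite /star /= tail2_w0.
elim: n f nf => [|n IH] f nf /=; first exact: nf.
have -> : tail2 (f 0) (f 1%N) = f 1%N.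
  have := nf 0; rewrite /head2 => /(canRL (mulKg _)); rewrite mulVg => e.
  by rewrite /tail2 e invg1 mul1g.
by apply: (IH (fun k => f k.+1)) => k; apply: nf.
Qed.

Lemma normal1 : normal (fun=> 1). Proof. by move=> n; apply: head21. Qed.

Lemma star1 f : star 1 f = f.
Proof.
apply/funext => n; rewrite /star; elim: n f => [|n IH] f /=; first exact: head21l.
by rewrite tail21l (IH (fun k => f k.+1)).
Qed.

Lemma star_word u f : reduced M u -> star (wordW u) f = foldr (fun s => star (r s)) f u.
Proof.
elim: u => [_|s u IH ru] /=; first exact: star1.
have redu := reduced_behead ru.
rewrite wordW_cons star_mul ?IH // -wordW_cons -ru len_r -redu //.
Qed.

Lemma w0_conj s : exists2 t, r t * w0 = w0 * r s & r s * w0 = w0 * r t.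
Proof.
have [t [_ E _]] := longest_conj (finset.in_setT s); exists t => //.
by apply: (mulgI w0); rewrite !mulgA -E longest2 -mulgA longest2 mulg1 mul1g.
Qed.

Lemma len_w0l s : len w0 = (1 + len (r s * w0))%N.
Proof. by have := weak_le_w0 (r s); rewrite /weak_le genV len_r. Qed.

Lemma len_w0r s : len w0 = (len (w0 * r s) + 1)%N.
Proof. by have [t <- _] := w0_conj s; rewrite (len_w0l t) addnC. Qed.

Lemma star_w0_gen s t f : r t * w0 = w0 * r s ->
  star w0 (star (r s) f) = star (r t) (star w0 f).
Proof.
move=> E; have E1 : w0 = r t * (w0 * r s) by rewrite -E genKl.
rewrite {1}E1 star_mul; last by rewrite -E1 len_r -E -len_w0l.
by congr (star _ _); rewrite -star_mul genKr // len_r -len_w0r.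
Qed.

Definition full_twist f := star w0 (star w0 f).

Lemma full_twist_gen s f : full_twist (star (r s) f) = star (r s) (full_twist f).
Proof.
have [t E1 E2] := w0_conj s.
by rewrite /full_twist (star_w0_gen _ E1) (star_w0_gen _ E2).
Qed.

Lemma full_twist_star v f : full_twist (star v f) = star v (full_twist f).
Proof.
rewrite -(wordW_rword v) !star_word; try exact: reduced_rword.
by elim: (rword v) => //= s u <-; rewrite full_twist_gen.
Qed.

(** The inverse of s acts as s^-1 Delta^2, where Delta is the lift of the longest element:
    this is the positive element (s w0) w0, and the missing powers of Delta^2 are counted by
    [negs]. *)
Definition act_letter (l : S * bool) (f : nat -> W) : nat -> W :=
  if l.2 then star (r l.1) f else star (r l.1 * w0) (star w0 f).
Definition act_word (u : word S) (f : nat -> W) := foldr act_letter f u.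
Definition negs (u : word S) := count (fun l => ~~ l.2) u.

Lemma act_word_cat u v f : act_word (u ++ v) f = act_word u (act_word v f).
Proof. exact: foldr_cat. Qed.

Lemma act_word_posword u f : act_word (posword u) f = foldr (fun s => star (r s)) f u.
Proof. by elim: u => //= s u <-. Qed.

Lemma full_twist_act_word n u f : iter n full_twist (act_word u f) = act_word u (iter n full_twist f).
Proof.
have H l g : full_twist (act_letter l g) = act_letter l (full_twist g).
  by rewrite /act_letter; case: l.2; rewrite !full_twist_star //= !full_twist_star.
elim: n => //= n ->; elim: u => //= l u <-; exact: H.
Qed.

Lemma normal_act_word u f : normal f -> normal (act_word u f).
Proof.
move=> nf; elim: u => //= l u IH; rewrite /act_letter; case: l.2;
  by do ?apply: star_normal.
Qed.

Lemma normal_full_twist n f : normal f -> normal (iter n full_twist f).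
Proof. by move=> nf; elim: n => //= n IH; do 2!apply: star_normal. Qed.

(** Cancellation of powers of the central element, in the form used to compare words. *)
Lemma full_twist_inj n f g : normal f -> normal g -> iter n full_twist f = iter n full_twist g -> f = g.
Proof.
have star_inj h k : normal h -> normal k -> star w0 h = star w0 k -> h = k.
  by move=> nh nk E; apply/funext => i; rewrite -(star_w0 i nh) E star_w0.
move=> nf ng; elim: n => //= n IH E; apply: IH.
have nif := normal_full_twist n nf; have nig := normal_full_twist n ng.
by apply: (star_inj) => //; apply: (star_inj) E; apply: star_normal.
Qed.

(** Equality in the Artin group implies equality of the actions once the powers of Delta^2
    introduced by the negative letters are balanced. For positive words there is nothing to
    balance, so the action of a positive word depends on the group element only. *)
Lemma act_word_wcongr u v f : wcongr (artin_rel M) u v -> normal f ->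
  iter (negs v) full_twist (act_word u f) = iter (negs u) full_twist (act_word v f).
Proof.
move=> uv; elim: uv f => {u v} [//|u v _ IH f nf|u v w _ IH1 _ IH2 f nf|||].
- by rewrite IH.
- apply: (@full_twist_inj (negs v)); try by apply/normal_full_twist/normal_act_word.
  rewrite -iterD addnC iterD IH1 // -iterD addnC iterD IH2 //.
  by rewrite -!iterD addnC.
- move=> u u' v v' _ IH1 _ IH2 f nf.
  rewrite /negs !count_cat -!/(negs _) !act_word_cat iterD full_twist_act_word IH2 //.
  rewrite -full_twist_act_word -iterD addnC iterD IH1; last exact: normal_act_word.
  by rewrite -iterD addnC.
- move=> s b f nf.
  have [t E1 E2] := w0_conj s.
  have -> : negs [:: (s, b); (s, ~~ b)] = 1%N by case: b.
  rewrite /= /act_letter /=; case: b => /=.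
    rewrite -star_mul; first by rewrite genKl.
    by rewrite genKl len_r -len_w0l.
  have E3 : r s * w0 * r t = w0 by rewrite -mulgA -E2 genKl.
  by rewrite (star_w0_gen _ E1) -star_mul E3 // len_r (len_w0l s) addnC.
- move=> u v [s t m st Mst] f nf.
  have n0 x : negs (posword x) = 0 by elim: x.
  rewrite -!posword_alt !n0 /= !act_word_posword -!star_word.
  + by rewrite (wordW_braid st Mst).
  + by rewrite /reduced size_alt alt_reduced // 1?eq_sym // => m'; rewrite cox_sym Mst => -[->].
  by rewrite /reduced size_alt alt_reduced // => m'; rewrite Mst => -[->].
Qed.

(** The greatest simple prefix of a positive word. *)
Definition left_head (u : seq S) : W := foldr (fun s => star (r s)) (fun=> 1) u 0.

Lemma left_head_eq u v : wordA u = wordA v -> left_head u = left_head v.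
Proof.
move=> /class_of_wordP /act_word_wcongr -/(_ _ normal1).
have n0 x : negs (posword x) = 0 by elim: x.
by rewrite !n0 /= !act_word_posword /left_head => ->.
Qed.

Lemma lift_head2_tail2 v w : artin_lift v * artin_lift w = artin_lift (head2 v w) * artin_lift (tail2 v w).
Proof.
have [_ h _] := absorbP v w; rewrite /head2 liftM // -mulgA; congr (_ * _).
by rewrite -liftM /tail2 ?mulVKg // -len_tail2.
Qed.

Lemma left_head_dvd u : exists v, wordA u = artin_lift (left_head u) * wordA v.
Proof.
elim: u => [|s u [v E]]; first by exists [::]; rewrite lift1 mul1g.
exists (rword (tail2 (r s) (left_head u)) ++ v).
by rewrite wordA_cons E -lift_gen mulgA lift_head2_tail2 wordA_cat mulgA.
Qed.

Lemma left_head_descent s u : len (r s * left_head (s :: u)) < len (left_head (s :: u)).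
Proof.
by have := weak_le_head2 (r s) (left_head u); rewrite /weak_le genV len_r add1n => ->.
Qed.

(** The greatest simple prefix has both s and t as descents, hence starts with the alternating
    word of length m(s, t), and its lift divides the word. *)
Lemma wordA_two_divisors s t p q : s != t -> wordA (s :: p) = wordA (t :: q) ->
  exists m v, M s t = Some m /\ wordA (s :: p) = wordA (alt s t m) * wordA v.
Proof.
move=> st E; have hs := left_head_descent s p; have ht := left_head_descent t q.
rewrite -(left_head_eq E) in ht.
have [m [Mst [w Ew lw]]] := descents2 st hs ht.
have [v Ev] := left_head_dvd (s :: p).
exists m, (rword w ++ v); split=> //.
rewrite Ev Ew liftM; last first.
  by rewrite -Ew lw alt_reduced // => m'; rewrite Mst => -[->].
by rewrite (lift_alt st Mst) wordA_cat mulgA.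
Qed.

(** * The central element of a parabolic subgroup *)

Section Garside.
Variable X : {set S}.
Local Notation w0 := (longest X).
(** The square of the lift of the longest element of W_X, central in A_X. *)
Definition garside2 : A := artin_lift w0 * artin_lift w0.

Lemma garside2_word : exists2 u, all (mem X) u & garside2 = wordA u.
Proof.
have [u [Xu Eu su]] := reduced_Xword (@longest_mem X).
exists (u ++ u); first by rewrite all_cat Xu.
by rewrite wordA_cat /garside2 -lift_reduced ?Eu // /reduced Eu.
Qed.

Lemma garside2_gen s : s \in X -> garside2 * a s = a s * garside2.
Proof.
move=> Xs; have [t [_ E _]] := longest_conj Xs.
have E' : w0 * r t = r s * w0.
  by apply: (mulgI w0); rewrite !mulgA longest2 mul1g -E -mulgA longest2 mulg1.
by rewrite /garside2 -mulgA (lift_conj (esym E)) mulgA (lift_conj E') mulgA.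
Qed.

Lemma garside2_central x : AX X x -> garside2 * x = x * garside2.
Proof.
have : centralizer (AX X) garside2 by rewrite -artin_centralizerE => s /garside2_gen.
exact.
Qed.

Lemma garside2_div s : s \in X -> exists2 u, all (mem X) u & garside2 = a s * wordA u.
Proof.
move=> Xs; have [WX1 WXM _] := parabolic_subgroup M X.
have WXs : WX X (r s) by exact: gen_parabolic.
have [u [Xu Eu su]] := reduced_Xword (@longest_mem X).
have [v [Xv Ev sv]] := reduced_Xword (WXM _ _ WXs (@longest_mem X)).
exists (v ++ u); first by rewrite all_cat Xv.
have l := weak_le_longest WXs; rewrite /weak_le genV in l.
have -> : garside2 = artin_lift (r s * (r s * w0)) * artin_lift w0 by rewrite genKl.
rewrite liftM ?genKl // lift_gen wordA_cat -mulgA; congr (_ * (_ * _)).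
  by rewrite -lift_reduced ?Ev // /reduced Ev.
by rewrite -lift_reduced ?Eu // /reduced Eu.
Qed.

Lemma garside2X_central n x : AX X x -> garside2 ^+ n * x = x * garside2 ^+ n.
Proof. by move=> /garside2_central h; apply: commute_sym; apply: commuteX; apply: commute_sym. Qed.

Lemma garside2X_word n : exists2 u, all (mem X) u & garside2 ^+ n = wordA u.
Proof.
elim: n => [|n [u Xu Eu]]; first by exists [::].
have [v Xv Ev] := garside2_word.
by exists (v ++ u); rewrite ?all_cat ?Xv // wordA_cat expgS -Eu -Ev.
Qed.

(** Since s divides Delta^2, a central power of it clears all denominators. *)
Lemma parabolic_fraction x : AX X x ->
  exists n, exists2 u, all (mem X) u & garside2 ^+ n * x = wordA u.
Proof.
have posV u : all (mem X) u ->
    exists n, exists2 v, all (mem X) v & garside2 ^+ n * (wordA u)^-1 = wordA v.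
  elim: u => [_|s u IH /= /andP[Xs Xu]].
    by exists 0, [::]; rewrite ?wordA0 ?invg1 ?mulg1 //.
  have [n [v Xv E]] := IH Xu; have [y Xy Ey] := garside2_div Xs.
  exists n.+1, (v ++ y); first by rewrite all_cat Xv.
  have [_ _ AXV] := generated_subgroup [set a x | x in [set` X]]%classic.
  have zu := garside2_central (AXV _ (wordA_parabolic Xu)).
  have zs : garside2 * (a s)^-1 = wordA y.
    apply: (mulgI (a s)); rewrite -Ey mulgA -garside2_gen // mulgK //.
  rewrite wordA_cons wordA_cat invgM; move: E zu zs; move: garside2 => z <- zu <-.
  by rewrite expgSr -!mulgA (mulgA z) zu !mulgA.
apply: (@generated_ind _ _
  (fun x => exists n, exists2 u, all (mem X) u & garside2 ^+ n * x = wordA u)).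
- by move=> _ [s Xs <-]; exists 0, [:: s]; rewrite ?mul1g //= andbT.
- by exists 0, [::]; rewrite ?mulg1.
- move=> y z [n [u Xu Eu]] [m [v Xv Ev]]; exists (m + n)%N, (u ++ v).
    by rewrite all_cat Xu.
  rewrite expgnDr wordA_cat -Ev -mulgA (mulgA _ y) Eu mulgA.
  by rewrite (garside2X_central m (wordA_parabolic Xu)) -mulgA.
move=> y [n [u Xu Eu]]; have [m [v Xv Ev]] := posV u Xu.
have [w Xw Ew] := garside2X_word n.
exists m, (v ++ w); first by rewrite all_cat Xv.
by rewrite wordA_cat -Ev -Ew -Eu invgM -!mulgA mulVg mulg1.
Qed.
End Garside.

(** * Parabolic divisors of positive words *)

Section Head.
Variable X : {set S}.
Definition Xfree (q : seq S) : Prop := forall s p, s \in X -> wordA q <> wordA (s :: p).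

Lemma Xfree_decomp u : exists d q, [/\ all (mem X) d, Xfree q & wordA u = wordA (d ++ q)].
Proof.
have [n] := ubnP (size u); elim: n u => // n IH u un.
have [free|] := pselect (Xfree u); first by exists [::], u.
move=> /existsNP[s /existsNP[p /not_implyP[Xs /contrapT E]]].
have [|d [q [Xd Fq Eq]]] := IH p; first by have := wordA_size E => /=; lia.
exists (s :: d), q; split=> //=; first by rewrite Xs.
by rewrite E !wordA_cons Eq.
Qed.

(** A divisor of d q with letters in X divides d. If c and d start with different letters s
    and t, the alternating word of length m(s, t) divides d q; removing its first letter and using
    induction, it divides d, which can thus be rewritten to start with s. *)
Lemma Xfree_divisor c d m q : all (mem X) c -> all (mem X) d -> Xfree q ->
  wordA (c ++ m) = wordA (d ++ q) -> exists2 e, all (mem X) e & wordA d = wordA (c ++ e).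
Proof.
move=> Xc Xd Fq; have [n] := ubnP (size d); elim: n c d m Xc Xd => // n IH c d m Xc Xd dn E.
case: c => [|s c] in Xc E *; first by exists d.
case: d => [|t d] in Xd dn E *; first by case/andP: Xc => /Fq -/(_ (c ++ m)); rewrite E.
move: Xc Xd dn => /= /andP[Xs Xc] /andP[Xt Xd]; rewrite ltnS => dn.
have [st|ts] := eqVneq t s.
  rewrite st /= in E *; rewrite !wordA_cons in E; move/mulgI: E => E.
  have [e Xe Ee] := IH c d m Xc Xd dn E.
  by exists e; rewrite // !wordA_cons Ee.
have [k [v [Mts Ek]]] := wordA_two_divisors ts (esym E).
have := wordA_braid ts Mts; have := cox_offdiag ts Mts.
case: k => // k in Mts Ek * => _ br.
move: Ek; rewrite /= !wordA_cons -mulgA => /mulgI; rewrite -wordA_cat => Ek.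
have [e Xe Ee] := IH _ _ v (all_alt k Xs Xt) Xd dn (esym Ek).
have Ed : wordA (t :: d) = a s * wordA (alt t s k ++ e).
  rewrite wordA_cons Ee wordA_cat mulgA -(wordA_cons M t) -[t :: _]/(alt t s k.+1) br /=.
  by rewrite wordA_cons wordA_cat mulgA.
have sd : size (alt t s k ++ e) = size d.
  by rewrite (wordA_size Ee) !size_cat !size_alt.
have Xd' : all (mem X) (alt t s k ++ e) by rewrite all_cat all_alt.
have [||e' Xe' Ee'] := IH c _ m Xc Xd'; first by rewrite sd.
  apply: (mulgI (a s)); rewrite (wordA_cat M (alt t s k ++ e)) mulgA -Ed -wordA_cat.
  by rewrite -wordA_cons.
by exists e' => //; rewrite -(wordA_cons M t) Ed Ee' -wordA_cons.
Qed.
End Head.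

(** * Normalizers of parabolic subgroups *)

(** After multiplication by a central element, g = d q with q free of left divisors in X. Each
    s in X satisfies q s = b q with b in A_X. Clearing denominators, c b = e for positive words
    c and e, and c divides e by [Xfree_divisor] applied to c q s = e q. So b is positive, of length
    one by homogeneity: a generator of X. *)
Lemma artin_normalizer_decomp (X : {set S}) g : artin_normalizer M X g ->
  exists x q, [/\ AX X x, g = x * q &
    forall s, s \in X -> exists2 t, t \in X & q * a s = a t * q].
Proof.
move=> Ng.
have allS x : AX [set: S] x.
  rewrite -[x]class_of_repr.
  have [H1 HM HV] : is_subgroup (AX [set: S]) := generated_subgroup _.
  have Hs s : AX [set: S] (a s).
    by apply: mem_generated; exists s => //=; exact: finset.in_setT.
  elim: (repr _) => [|[s b] w IH]; [exact: H1|rewrite -cat1s class_of_cat; apply: (HM) => //].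
  by case: b; [exact: Hs | rewrite class_letterV; apply: HV; exact: Hs].
have [AX1 AXM AXV] : is_subgroup (AX X) := generated_subgroup _.
have [k [u _ Eu]] := parabolic_fraction (allS g).
set z := garside2 [set: S] ^+ k in Eu.
have zC x : z * x = x * z by apply: garside2X_central; apply: allS.
have [d [q [Xd Fq Eq]]] := Xfree_decomp X u.
have AXd : AX X (wordA d) := wordA_parabolic Xd.
rewrite wordA_cat in Eq.
have Eg : g = wordA d * (z^-1 * wordA q).
  by apply: (mulgI z); rewrite Eu Eq mulgA zC -mulgA mulVKg.
exists (wordA d), (z^-1 * wordA q); split=> // s Xs.
have [h AXh gh] := Ng s Xs.
pose b := (wordA d)^-1 * h * wordA d.
have AXb : AX X b := AXM _ _ (AXM _ _ (AXV _ AXd) AXh) AXd.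
have Eb : wordA q * a s = b * wordA q.
  apply: (mulgI (wordA d)); rewrite /b !mulgA mulgV mul1g -Eq -mulgA -Eq -Eu.
  by rewrite -mulgA gh (mulgA z) (zC h) -mulgA.
have [n [e Xe Ee]] := parabolic_fraction AXb.
have [c Xc Ec] := garside2X_word X n.
have Ecq : wordA (c ++ (q ++ [:: s])) = wordA (e ++ q).
  by rewrite !wordA_cat wordA1 -Ec -Ee Eb mulgA.
have [f Xf Ef] := Xfree_divisor Xc Xe Fq Ecq.
have bf : b = wordA f.
  by apply: (mulgI (wordA c)); rewrite -wordA_cat -Ef -Ee Ec.
have Eqs : wordA (q ++ [:: s]) = wordA (f ++ q) by rewrite !wordA_cat wordA1 Eb bf.
have := wordA_size Eqs; rewrite !size_cat /=.
case: f Xf bf {Ef Eqs} => [|t [|? ?]] /= Xf bf; try lia.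
move=> _; exists t; first by case/andP: Xf.
by rewrite -mulgA Eb bf wordA1 !mulgA; congr (_ * _); apply: (mulgI z); rewrite !mulgA mulgV mul1g zC mulgK.
Qed.

Lemma artin_normalizerE (X : {set S}) : artin_normalizer M X = normalizer (AX X).
Proof.
apply/seteqP; split=> g.
  move=> /artin_normalizer_decomp[x [q [AXx -> qX]]].
  have [_ NM _] := normalizer_subgroup (AX X); apply: NM.
    by apply: subgroup_normalizer => //; apply: generated_subgroup.
  by apply: permuting_normalizer => //; apply: artin_gen_inj.
move=> /normalizerP[gX _] s Xs; exists (g * a s * g^-1); last by rewrite mulgVK.
by apply: gX; apply: mem_generated; exists s.
Qed.

(** With q minimal in its coset, b = q s q^-1 lies in W_X and len b + len q = len (q s) is at
    most len q + 1, so b is a generator. *)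
Lemma coxeter_normalizer_decomp (X : {set S}) w : normalizer (WX X) w ->
  exists d q, [/\ WX X d, w = d * q &
    forall s, s \in X -> exists2 t, t \in X & q * r s = r t * q].
Proof.
move=> Nw; have [WX1 WXM WXV] := parabolic_subgroup M X.
have [d WXd qmin] := Xmin_decomp X w.
exists d, (d^-1 * w); split=> //; first by rewrite mulVKg.
set q := d^-1 * w in qmin *.
have /normalizerP[qX _] : normalizer (WX X) q.
  have [_ NM _] := normalizer_subgroup (WX X); apply: NM => //.
  by apply: subgroup_normalizer; [exact: parabolic_subgroup | apply: WXV].
move=> s Xs; have WXs : WX X (r s) by exact: gen_parabolic.
have WXb := qX _ WXs; set b := q * r s * q^-1 in WXb.
have Eb : b * q = q * r s by rewrite mulgVK.
have l := len_Xmin WXb qmin; rewrite Eb in l.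
have l2 := lenM q (r s); rewrite len_r in l2.
have [u [Xu Eu su]] := reduced_Xword WXb.
case: u Xu Eu su => [|t [|x u]] /= Xu Eu su.
- exfalso; have : len (r s) = 0 by rewrite -(mulKg q (r s)) -Eb -Eu wordW0 mul1g mulVg len1.
  by rewrite len_r.
- by exists t; [case/andP: Xu | rewrite -Eb -Eu wordW1].
by exfalso; move: l l2 su; len_lia.
Qed.

(** Injectivity: if the projection of an element q permuting X is c x with c centralizing
    W_X and x in W_X, then x induces the same permutation of X as q, and so does its lift, so q and
    the lift of x differ by an element centralizing A_X. Surjectivity: elements of W permuting X
    lift to elements permuting X. *)
Lemma normalizer_quotient_iso (X : {set S})
    (nA : normal_in (set_mul (centralizer (AX X)) (AX X)) (normalizer (AX X)))
    (nW : normal_in (set_mul (centralizer (WX X)) (WX X)) (normalizer (WX X))) :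
  group_isomorphic (quotient_group nA) (quotient_group nW).
Proof.
have [AX1 AXM AXV] : is_subgroup (AX X) := generated_subgroup _.
have [WX1 WXM WXV] : is_subgroup (WX X) := parabolic_subgroup M X.
apply: (@quotient_iso _ _ _ _ _ _ nA nW artin_proj (@artin_projM S M)).
- move=> g /normalizerP[g1 g2]; apply/normalizerP; split=> h WXh.
    by have := artin_proj_parabolic (g1 _ (lift_parabolic WXh)); rewrite !artin_projM artin_projV artin_proj_lift.
  by have := artin_proj_parabolic (g2 _ (lift_parabolic WXh)); rewrite !artin_projM artin_projV artin_proj_lift.
- move=> g Ng; split=> [[c Cc [x WXx cx]]|[c Cc [x AXx <-]]]; last first.
    exists (artin_proj c); last by exists (artin_proj x); [exact: artin_proj_parabolic | rewrite artin_projM].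
    move=> h WXh; have := Cc _ (lift_parabolic WXh).
    by move/(congr1 artin_proj); rewrite !artin_projM artin_proj_lift.
  rewrite -artin_normalizerE in Ng.
  have [y [q [AXy Eg qX]]] := artin_normalizer_decomp Ng.
  have WXy := artin_proj_parabolic AXy.
  have [x' WXx' Eq] : exists2 x', WX X x' & artin_proj q = c * x'.
    exists ((artin_proj y)^-1 * x); first by apply: WXM => //; apply: WXV.
    by rewrite mulgA (Cc _ (WXV _ WXy)) -mulgA cx Eg artin_projM mulKg.
  pose c' := (artin_lift x')^-1 * q.
  have Cc' : centralizer (AX X) c'.
    rewrite -artin_centralizerE => s Xs; have [t Xt qst] := qX s Xs.
    have WXt : WX X (r t) by exact: gen_parabolic.
    have : x' * r s = r t * x'.
      apply: (mulgI c); rewrite !mulgA -Eq Cc // -mulgA -Eq.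
      by rewrite -!artin_proj_gen -!artin_projM qst.
    move=> /lift_conj E; apply: (mulgI (artin_lift x')).
    by rewrite /c' !mulgA mulgV mul1g qst E mulgK.
  have AXx' := lift_parabolic WXx'.
  exists c' => //; exists (y * artin_lift x'); first exact: AXM.
  rewrite Cc' ?Eg /c' -?mulgA ?mulVKg //; exact: AXM.
move=> h Nh; have [d [q [WXd Eh qX]]] := coxeter_normalizer_decomp Nh.
exists (artin_lift q).
  apply: permuting_normalizer; first exact: artin_gen_inj.
  by move=> s /qX [t Xt E]; exists t => //; apply: lift_conj.
have /normalizerP[_ q2] : normalizer (WX X) q by apply: permuting_normalizer => //; exact: gen_inj.
exists 1; first by move=> ? _; rewrite mul1g mulg1.
exists (q^-1 * d^-1 * q); first by apply: q2; apply: WXV.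
by rewrite artin_proj_lift Eh invgM mul1g.
Qed.
End Spherical.

Theorem mainTheorem3 (S : finType) (M : coxeter_matrix S) (X : {set S})
    (M_spherical : spherical M) :
  exists (nA : normal_in (set_mul (artin_centralizer M X) (artin_parabolic M X))
                         (artin_normalizer M X))
         (nW : normal_in (set_mul (centralizer (coxeter_parabolic M X))
                                  (coxeter_parabolic M X))
                         (normalizer (coxeter_parabolic M X))),
    group_isomorphic (quotient_group nA) (quotient_group nW).
Proof.
rewrite artin_centralizerE artin_normalizerE //.
have nA := normal_centralizer_mul (generated_subgroup (artin_gen M @` [set` X])%classic).
have nW := normal_centralizer_mul (parabolic_subgroup M X).
by exists nA, nW; apply: normalizer_quotient_iso.
Qed.
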